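(* Let $g\ge 2$. The generalized cone complex $T^{\mathrm{trop}}_g=\varinjlim(\sigma_{(G,P)},\iota_\gamma)$ satisfies: (1) its points are in natural bijection with isomorphism classes of pairs $(\Gamma,\theta)$, where $\Gamma$ is a tropical curve of genus $g$ and $\theta\in T^{\mathrm{trop}}_\Gamma$ (two pairs identified when $\Gamma\cong\Gamma'$ via an isomorphism carrying $\theta$ to $\theta'$), and there is a stratification $T^{\mathrm{trop}}_g=\bigsqcup_{[G,P]} T^{\mathrm{trop}}_{(G,P)}$ over isomorphism classes of pairs $(G,P)$ with $G$ a stable weighted graph of genus $g$ and $P\in\mathcal C_G$, modulo $\operatorname{Aut}(G)$; (2) $T^{\mathrm{trop}}_{(G,P)}\cong \sigma^o_{(G,P)}/\operatorname{Aut}(G,P)$; (3) $T^{\mathrm{trop}}_g$ is connected and of pure dimension $3g-3$; (4) $T^{\mathrm{trop}}_{(G',P')}\subseteq\overline{T^{\mathrm{trop}}_{(G,P)}}$ if and only if $(G,P)\ge(G',P')$.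
   Context: A stable weighted graph $(G,w)$, $G=(V,E)$ finite connected (loops and multiple edges allowed), has $w\colon V\to\mathbb Z_{\ge0}$ with $2w(v)-2+\deg(v)>0$; its genus is $\sum w(v)+|E|-|V|+1$. A tropical curve is $\Gamma=(G,w,\ell)$ with $(G,w)$ stable and $\ell\colon E\to\mathbb R_{>0}$; $T^{\mathrm{trop}}_\Gamma$ is its set of theta-characteristics (classes $[D]\in\operatorname{Pic}(\Gamma)$ with $[2D]=[K_\Gamma]$, $K_\Gamma=\sum_v(2w(v)-2+\deg(v))v$). $\mathcal C_G$ is the set of $P\subseteq E$ such that every vertex has even degree in $P$; for $P\in\mathcal C_G$ let $T_P=\sum_{v}(\frac{\deg_P(v)}2-1+w(v))v+\sum_{e\notin P}p_e$ ($p_e$ the mid-point of $e$); $P\mapsto[T_P]$ is a bijection $\mathcal C_G\to T^{\mathrm{trop}}_\Gamma$. For pairs $(G,P),(G',P')$ with $G,G'$ stable of genus $g$, write $(G,P)\ge(G',P')$ if there is a weighted edge contraction $\gamma\colon G\to G'$ (contracting a set of edges, so that $E(G')$ is identified with the non-contracted edges and weights are updated to preserve genus) with $P'=\gamma_*P$, the set of non-contracted edges of $P$. Let $\operatorname{Aut}(G,P)$ be the subgroup of $\operatorname{Aut}(G)$ (weight-preserving) fixing $P$. Consider the category whose objects are isomorphism classes of pairs $(G,P)$ and whose arrows are generated by such contractions and by elements of $\operatorname{Aut}(G,P)$. To $(G,P)$ associate the cone $\sigma_{(G,P)}=\mathbb R_{\ge0}^{E(G)}$ (integral structure $\mathbb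 Z^{E(G)}$), with interior $\sigma^o_{(G,P)}=\mathbb R^{E(G)}_{>0}$; to a contraction $\gamma$ the face inclusion $\iota_\gamma\colon\sigma_{(G',P')}\hookrightarrow\sigma_{(G,P)}$ onto the face where coordinates of contracted edges vanish; to an automorphism the induced coordinate permutation. $T^{\mathrm{trop}}_g$ is the colimit of this diagram; a point $\underline l\in\sigma^o_{(G,P)}$ corresponds to $(\Gamma,[T_P])$ with $\Gamma=(G,w,\ell)$, $\ell(e)=l_e$. $T^{\mathrm{trop}}_{(G,P)}$ denotes the set of isomorphism classes of pairs $(\Gamma,[T_P])$ with $\Gamma$ of combinatorial type $(G,w)$. *)

(* Defs.v *)
From HB Require Import structures.
From mathcomp Require Import all_boot all_order all_algebra.
From mathcomp Require Import reals.
From Stdlib Require Import Relations.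
Unset Printing Implicit Defensive.
Import Order.TTheory GRing.Theory Num.Theory.
Local Open Scope ring_scope.

(* Weighted graphs (loops and multiple edges allowed).                 *)
(* Vertices are 'I_nv, edges are 'I_ne; every edge e has an (arbitrary)*)
(* orientation src e -> tgt e, used only for parametrising the edge.    *)
Record wgraph := WGraph {
  nv : nat; ne : nat;
  src : 'I_ne -> 'I_nv; tgt : 'I_ne -> 'I_nv;
  wt : 'I_nv -> nat }.
Arguments src : clear implicits. Arguments tgt : clear implicits.
Arguments wt : clear implicits.

(* degree (a loop counts twice) *)
Definition deg (G : wgraph) (v : 'I_(nv G)) : nat :=
  #|[set e | src G e == v]| + #|[set e | tgt G e == v]|.

Definition degP (G : wgraph) (P : {set 'I_(ne G)}) (v : 'I_(nv G)) : nat :=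
  #|[set e in P | src G e == v]| + #|[set e in P | tgt G e == v]|.

Definition gadj (G : wgraph) : rel 'I_(nv G) :=
  [rel u v | [exists e, ((src G e == u) && (tgt G e == v))
                     || ((src G e == v) && (tgt G e == u))]].

Definition gconnected (G : wgraph) : Prop :=
  (0 < nv G)%N /\ forall u v, connect (gadj G) u v.

Definition gstable (G : wgraph) : Prop :=
  forall v, (2 < 2 * wt G v + deg G v)%N.

Definition genus (G : wgraph) : int :=
  (\sum_(v : 'I_(nv G)) wt G v)%:Z + (ne G)%:Z - (nv G)%:Z + 1.

Definition sgraph (g : nat) (G : wgraph) : Prop :=
  gconnected G /\ gstable G /\ genus G = g%:Z.

(* P is in the cycle space C_G *)
Definition evenP (G : wgraph) (P : {set 'I_(ne G)}) : Prop :=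
  forall v, ~~ odd (degP G P v).

Definition giso (G G' : wgraph) (phiV : 'I_(nv G) -> 'I_(nv G'))
  (phiE : 'I_(ne G) -> 'I_(ne G')) (fl : 'I_(ne G) -> bool) : Prop :=
  bijective phiV /\ bijective phiE /\
  (forall v, wt G' (phiV v) = wt G v) /\
  (forall e, if fl e then src G' (phiE e) = phiV (tgt G e) /\
                          tgt G' (phiE e) = phiV (src G e)
             else src G' (phiE e) = phiV (src G e) /\
                  tgt G' (phiE e) = phiV (tgt G e)).

(* Divisors and linear equivalence on the metric graph (G, l).          *)
(* A point of Gamma is either a vertex v, or the point at distance t    *)
(* from src e on the edge e, with 0 < t < l e.  A divisor is a pair     *)
(* (Dv, De): Dv v is the coefficient of vertex v, De e t the            *)
(* coefficient of the interior point t of e (De e t = 0 if t is not in  *)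
(* ]0, l e[, and finitely many nonzero ones).                           *)
Section Metric.
Variable R : realType.

Definition wf_div (G : wgraph) (l : 'I_(ne G) -> R)
  (Dv : 'I_(nv G) -> int) (De : 'I_(ne G) -> R -> int) : Prop :=
  forall e, (forall t, De e t != 0 -> 0 < t < l e) /\
            exists s : seq R, forall t, De e t != 0 -> t \in s.

Definition pw_affine (phi : R -> R) (a b : R) : Prop :=
  exists s : seq R,
    let pts := a :: rcons s b in
    sorted <%R pts /\
    forall i, (i.+1 < size pts)%N ->
      exists k : int, forall t, nth 0 pts i <= t <= nth 0 pts i.+1 ->
        phi t = phi (nth 0 pts i) + k%:~R * (t - nth 0 pts i).

Definition fwd_slope (phi : R -> R) (t : R) (k : int) : Prop :=
  exists2 d : R, 0 < d & forall h, 0 < h < d -> phi (t + h) = phi t + k%:~R * h.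
Definition bwd_slope (phi : R -> R) (t : R) (k : int) : Prop :=
  exists2 d : R, 0 < d & forall h, 0 < h < d -> phi (t - h) = phi t + k%:~R * h.

(* (fv, fe) is a rational function on Gamma: fv on vertices, fe e t the *)
(* value at distance t from src e along e                               *)
Definition is_rat (G : wgraph) (l : 'I_(ne G) -> R)
  (fv : 'I_(nv G) -> R) (fe : 'I_(ne G) -> R -> R) : Prop :=
  forall e, fe e 0 = fv (src G e) /\ fe e (l e) = fv (tgt G e) /\
            pw_affine (fe e) 0 (l e).

Definition div_is (G : wgraph) (l : 'I_(ne G) -> R)
  (fv : 'I_(nv G) -> R) (fe : 'I_(ne G) -> R -> R)
  (Dv : 'I_(nv G) -> int) (De : 'I_(ne G) -> R -> int) : Prop :=
  exists a b : 'I_(ne G) -> int,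
    (forall e, fwd_slope (fe e) 0 (a e) /\ bwd_slope (fe e) (l e) (b e)) /\
    (forall v, Dv v = \sum_(e | src G e == v) a e + \sum_(e | tgt G e == v) b e) /\
    (forall e t, 0 < t < l e -> exists k1 k2,
        fwd_slope (fe e) t k1 /\ bwd_slope (fe e) t k2 /\ De e t = k1 + k2) /\
    (forall e t, ~~ (0 < t < l e) -> De e t = 0).

Definition lin_equiv (G : wgraph) (l : 'I_(ne G) -> R)
  (Dv1 : 'I_(nv G) -> int) (De1 : 'I_(ne G) -> R -> int)
  (Dv2 : 'I_(nv G) -> int) (De2 : 'I_(ne G) -> R -> int) : Prop :=
  exists fv fe, is_rat G l fv fe /\
    div_is G l fv fe (fun v => Dv1 v - Dv2 v) (fun e t => De1 e t - De2 e t).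

Definition canKv (G : wgraph) (v : 'I_(nv G)) : int :=
  2 * (wt G v)%:Z - 2 + (deg G v)%:Z.
Definition canKe (G : wgraph) (e : 'I_(ne G)) (t : R) : int := 0.

Definition theta (G : wgraph) (l : 'I_(ne G) -> R)
  (Dv : 'I_(nv G) -> int) (De : 'I_(ne G) -> R -> int) : Prop :=
  wf_div G l Dv De /\
  lin_equiv G l (fun v => 2 * Dv v) (fun e t => 2 * De e t) (canKv G) (canKe G).

Definition TPv (G : wgraph) (P : {set 'I_(ne G)}) (v : 'I_(nv G)) : int :=
  ((degP G P v)./2)%:Z - 1 + (wt G v)%:Z.
Definition TPe (G : wgraph) (P : {set 'I_(ne G)}) (l : 'I_(ne G) -> R)
  (e : 'I_(ne G)) (t : R) : int :=
  if (e \notin P) && (t == l e / 2) then 1 else 0.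

Record tpair := TPair {
  pG : wgraph; pl : 'I_(ne pG) -> R;
  pdv : 'I_(nv pG) -> int; pde : 'I_(ne pG) -> R -> int }.
Arguments pl : clear implicits. Arguments pdv : clear implicits.
Arguments pde : clear implicits.

Definition valid_tpair (g : nat) (p : tpair) : Prop :=
  sgraph g (pG p) /\ (forall e, 0 < pl p e) /\ theta (pG p) (pl p) (pdv p) (pde p).

Definition pair_iso (p q : tpair) : Prop :=
  exists phiV phiE fl, giso (pG p) (pG q) phiV phiE fl /\
    (forall e, pl q (phiE e) = pl p e) /\
    lin_equiv (pG p) (pl p)
      (fun v => pdv q (phiV v))
      (fun e t => pde q (phiE e) (if fl e then pl p e - t else t))
      (pdv p) (pde p).
End Metric.

Record cpair := CPair { cG : wgraph; cP : {set 'I_(ne cG)} }.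
Arguments cP : clear implicits.

Definition valid_cpair (g : nat) (c : cpair) : Prop :=
  sgraph g (cG c) /\ evenP (cG c) (cP c).

Definition cadj (G : wgraph) (m : nat) (gE : 'I_m -> 'I_(ne G)) : rel 'I_(nv G) :=
  [rel u v | [exists e, (e \notin codom gE) &&
     (((src G e == u) && (tgt G e == v)) || ((src G e == v) && (tgt G e == u)))]].

(* (gV, gE, fl) is a weighted edge contraction G -> G' (composed with an *)
(* isomorphism) with P' = gamma_* P : the contracted edges are those not *)
(* in the image of gE, gE identifies E(G') with the non-contracted edges *)
Definition is_morph (G G' : wgraph) (P : {set 'I_(ne G)}) (P' : {set 'I_(ne G')})
  (gV : 'I_(nv G) -> 'I_(nv G')) (gE : 'I_(ne G') -> 'I_(ne G))
  (fl : 'I_(ne G') -> bool) : Prop :=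
  injective gE /\
  (forall e', if fl e' then src G' e' = gV (tgt G (gE e')) /\
                            tgt G' e' = gV (src G (gE e'))
              else src G' e' = gV (src G (gE e')) /\
                   tgt G' e' = gV (tgt G (gE e'))) /\
  (forall e, e \notin codom gE -> gV (src G e) = gV (tgt G e)) /\
  (forall v', exists v, gV v = v') /\
  (forall u v, gV u = gV v -> connect (cadj G (ne G') gE) u v) /\
  (forall v', (wt G' v')%:Z =
      (\sum_(v | gV v == v') wt G v)%:Z
      + #|[set e | (e \notin codom gE) && (gV (src G e) == v')]|%:Z
      - #|[set v | gV v == v']|%:Z + 1) /\
  (forall e', (e' \in P') = (gE e' \in P)).

Definition cge (c c' : cpair) : Prop :=
  exists gV gE fl, is_morph (cG c) (cG c') (cP c) (cP c') gV gE fl.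

Definition cpair_iso (c c' : cpair) : Prop :=
  exists phiV phiE fl, giso (cG c) (cG c') phiV phiE fl /\
    forall e, (phiE e \in cP c') = (e \in cP c).

(* a cone sigma_(G,P) is maximal: it is not a proper face of any cone *)
Definition cmaximal (g : nat) (c : cpair) : Prop :=
  forall c', valid_cpair g c' -> forall gV gE fl,
    is_morph (cG c') (cG c) (cP c') (cP c) gV gE fl -> forall e, e \in codom gE.

Section Cone.
Variable R : realType.

(* points of the disjoint union of the cones sigma_(G,P) *)
Record cpt := CPt { ci : cpair; cx : 'I_(ne (cG ci)) -> R }.
Arguments cx : clear implicits.

Definition valid_cpt (g : nat) (p : cpt) : Prop :=
  valid_cpair g (ci p) /\ forall e, 0 <= cx p e.

Definition cstep (g : nat) (p q : cpt) : Prop :=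
  valid_cpt g p /\ valid_cpt g q /\
  exists gV gE fl, is_morph (cG (ci p)) (cG (ci q)) (cP (ci p)) (cP (ci q)) gV gE fl /\
    (forall e', cx p (gE e') = cx q e') /\
    (forall e, e \notin codom gE -> cx p e = 0).

Definition ceq (g : nat) : relation cpt := clos_refl_sym_trans cpt (cstep g).

Definition Ttrop (g : nat) : Type :=
  {C : cpt -> Prop | exists p, valid_cpt g p /\ C = ceq g p}.

(* colimit (quotient) topology *)
Definition open_T (g : nat) (U : Ttrop g -> Prop) : Prop :=
  forall p, valid_cpt g p -> (exists x, U x /\ sval x p) ->
    exists2 eps : R, 0 < eps & forall y : 'I_(ne (cG (ci p))) -> R,
      (forall e, 0 <= y e) -> (forall e, `|y e - cx p e| < eps) ->
      exists x, U x /\ sval x (CPt (ci p) y).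

Definition closure_T (g : nat) (A : Ttrop g -> Prop) (x : Ttrop g) : Prop :=
  forall U, open_T g U -> U x -> exists y, U y /\ A y.

Definition connected_T (g : nat) : Prop :=
  forall U V : Ttrop g -> Prop, open_T g U -> open_T g V ->
    (forall x, U x \/ V x) -> (exists x, U x) -> (exists x, V x) ->
    exists x, U x /\ V x.

Definition stratum (g : nat) (c : cpair) (x : Ttrop g) : Prop :=
  exists l : 'I_(ne (cG c)) -> R, (forall e, 0 < l e) /\ sval x (CPt c l).
End Cone.

(* Main.v *)
Require Import Defs.
From HB Require Import structures.
From mathcomp Require Import all_boot all_order all_algebra.
From mathcomp Require Import reals boolp.
From mathcomp Require Import zify ring lra.
From Stdlib Require Import Relations.
Import Order.TTheory GRing.Theory Num.Theory.
Local Open Scope ring_scope.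

Set Implicit Arguments.
Unset Strict Implicit.

(** Contractions compose, and a contraction [kappa] of [G] factors through a
    contraction [gamma] of [G] as soon as [gamma] contracts no edge that [kappa]
    keeps.  Hence, for a set [O] of positive length vectors on [(G, P)], the
    property "some contraction to [(G, P)] pulls the coordinates of [p] back into
    [O]" is invariant under the relation defining the colimit.  This one
    invariance gives uniqueness of the representatives with positive coordinates
    (so strata are quotients of open cones by automorphisms), and an open star
    around each stratum (so closures of strata are governed by contractions).
    All cones share their apex, the vertex of weight [g], so the complex is
    connected; a cone of dimension other than [3 g - 3] has a vertex of positive
    weight or of valence at least 4, from which a new edge can be pulled out.

    The bijection [P |-> [T_P]] comes from [2 T_P - K = div h_P], where [h_P] is
    the tent function with slopes 1 or -1 on the edges outside [P]. *)

(** * Contractions *)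

(** The relation on points is generated by zigzags of face maps and automorphisms, and a zigzag
    between two positive vectors may pass through boundary points of other cones. An induction along
    it needs a predicate that makes sense at every point of every cone; this is why [contracts_to]
    speaks only of a contraction out of the cone at hand and of positivity of the kept coordinates.
    Contractions are taken up to an isomorphism of the target, so isomorphisms and automorphisms are
    the contractions that contract nothing, and one kind of arrow covers the whole diagram. The
    numerical side comes from one fact: the weight of a vertex is the genus of the connected
    subgraph contracted to it, so that genus, stability and parity can all be computed fibre by
    fibre. *)

Lemma degPE (G : wgraph) (P : {set 'I_(ne G)}) (v : 'I_(nv G)) :
  degP G P v = (\sum_(e in P) ((src G e == v) + (tgt G e == v)))%N.
Proof.
rewrite /degP big_split /= -!sum1dep_card !big_mkcondr /=.
by congr addn; apply: eq_bigr => e _; case: eqP.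
Qed.

Lemma deg_degPT (G : wgraph) (v : 'I_(nv G)) : deg G v = degP G setT v.
Proof.
by rewrite /deg /degP; congr addn; apply: eq_card => e; rewrite !inE.
Qed.

Lemma sum_codom (m n : nat) (h : 'I_m -> 'I_n) (Q : pred 'I_n)
    (F : 'I_n -> nat) : injective h ->
  (\sum_(e | (e \in codom h) && Q e) F e = \sum_(e' | Q (h e')) F (h e'))%N.
Proof.
move=> h_inj.
transitivity (\sum_(e in [set h x | x in [set y | Q (h y)]]) F e)%N.
  apply: eq_bigl => e; apply/andP/imsetP.
    by move=> [/codomP[x ->] Qx]; exists x; rewrite ?inE.
  by move=> [x]; rewrite inE => Qx ->; rewrite codom_f.
rewrite big_imset /=; last by move=> x y _ _; apply: h_inj.
by apply: eq_bigl => x; rewrite inE.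
Qed.

Lemma sum_fibers (I J K : finType) (f : I -> J) (h : J -> K) (k : K)
    (Q : pred I) (F : I -> nat) :
  (\sum_(j | h j == k) \sum_(i | Q i && (f i == j)) F i =
   \sum_(i | Q i && (h (f i) == k)) F i)%N.
Proof.
rewrite [RHS](partition_big f (fun j => h j == k)) /=; last by move=> i /andP[].
apply: eq_bigr => j /eqP <-; apply: eq_bigl => i.
by case: (f i =P j) => [->|]; rewrite ?eqxx ?andbT ?andbF.
Qed.

Section Morphisms.
Variables (G G' : wgraph) (P : {set 'I_(ne G)}) (P' : {set 'I_(ne G')}).
Variables (gV : 'I_(nv G) -> 'I_(nv G')) (gE : 'I_(ne G') -> 'I_(ne G)).
Variable fl : 'I_(ne G') -> bool.
Hypothesis gM : is_morph G G' P P' gV gE fl.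

Lemma morph_inj : injective gE. Proof. by case: gM. Qed.

Lemma morph_ends e' :
  (src G' e' = gV (src G (gE e')) /\ tgt G' e' = gV (tgt G (gE e'))) \/
  (src G' e' = gV (tgt G (gE e')) /\ tgt G' e' = gV (src G (gE e'))).
Proof. by case: gM => _ [/(_ e')]; case: (fl e') => -[-> ->] _; [right|left]. Qed.

Lemma morph_contr e : e \notin codom gE -> gV (src G e) = gV (tgt G e).
Proof. by case: gM => _ [_ [H _]]; apply: H. Qed.

Lemma morph_surj v' : exists v, gV v = v'.
Proof. by case: gM => _ [_ [_ [H _]]]; apply: H. Qed.

Lemma morph_fiber u v : gV u = gV v -> connect (cadj G (ne G') gE) u v.
Proof. by case: gM => _ [_ [_ [_ [H _]]]]; apply: H. Qed.

(** The genus formula of a fibre, with the negative term moved to the left so that it lives in the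
    natural numbers and can be summed over vertices. *)
Lemma morph_wt v' :
  (wt G' v' + #|[set v | gV v == v']| =
   \sum_(v | gV v == v') wt G v
     + #|[set e | (e \notin codom gE) && (gV (src G e) == v')]| + 1)%N.
Proof.
case: gM => _ [_ [_ [_ [_ [/(_ v') H _]]]]].
by move: H; set a := (\sum_(_ | _) _)%N; lia.
Qed.

Lemma morph_P e' : (e' \in P') = (gE e' \in P).
Proof. by case: gM => _ [_ [_ [_ [_ [_ H]]]]]; apply: H. Qed.

Lemma morph_connect_eq u v : connect (cadj G (ne G') gE) u v -> gV u = gV v.
Proof.
move=> /connectP [p pp ->] {v}; elim: p u pp => //= x p IH u /andP[ux /IH <-].
have /existsP[e /andP[/morph_contr He]] := ux.
by case/orP=> /andP[/eqP <- /eqP <-].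
Qed.

(** Half-edges are counted over a fibre: a kept edge contributes its ends at [v'], while a
    contracted edge has both ends in the same fibre and contributes 2. Modulo 2 this preserves the
    cycle space. *)
Lemma morph_degP v' :
  (\sum_(v | gV v == v') degP G P v = degP G' P' v' +
     2 * #|[set e in P | (e \notin codom gE) && (gV (src G e) == v')]|)%N.
Proof.
have fib (x : 'I_(nv G)) :
    (\sum_(v | gV v == v') (x == v))%N = (gV x == v' : nat).
  case: (gV x =P v') => [gx|gx].
    rewrite (bigD1 x) ?gx ?eqxx //= big1 ?addn0 // => v /andP[_].
    by rewrite eq_sym => /negbTE ->.
  by rewrite big1 // => v /eqP gv; case: eqP => // xv; rewrite xv in gx.
under eq_bigr do rewrite degPE.
rewrite exchange_big /=; under eq_bigr do rewrite big_split !fib.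
rewrite (bigID (mem (codom gE))) /=; congr addn.
  rewrite (eq_bigl _ _ (fun=> andbC _ _)) sum_codom ?degPE; last exact: morph_inj.
  apply: eq_big => [e'|e' _]; first by rewrite -morph_P.
  by case: (morph_ends e') => -[-> ->] //; rewrite addnC.
rewrite -sum1dep_card big_distrr /= (eq_bigl _ _ (fun=> andbA _ _ _)).
rewrite [RHS]big_mkcondr; apply: eq_bigr => e /andP[_ /morph_contr <-].
by case: eqP.
Qed.

Lemma morph_genus : genus G' = genus G.
Proof.
have sum_wt : (\sum_v' \sum_(v | gV v == v') wt G v = \sum_v wt G v)%N.
  by rewrite [RHS](partition_big gV predT).
have sum_n : (\sum_v' #|[set v | gV v == v']| = nv G)%N.
  rewrite -[RHS]card_ord -sum1_card (partition_big gV predT) //=.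
  by apply: eq_bigr => v' _; rewrite sum1dep_card.
have sum_c : (\sum_v' #|[set e | (e \notin codom gE) && (gV (src G e) == v')]|
    + ne G' = ne G)%N.
  rewrite -[in RHS](card_ord (ne G)) -(cardC (mem (codom gE))) addnC.
  rewrite (card_codom morph_inj) card_ord; congr addn.
  rewrite -sum1_card (partition_big (fun e => gV (src G e)) predT) //=.
  by apply: eq_bigr => v' _; rewrite sum1dep_card.
have := eq_bigr _ (fun v' (_ : xpredT v') => morph_wt v').
move/(_ 0%N addn (index_enum _)); rewrite !big_split /= sum_wt sum_n sum1_card card_ord.
rewrite /genus; move: sum_c; set c := (\sum_(_ < _) #|_|)%N.
by set a := (\sum_(_ < _) wt G' _)%N; set b := (\sum_(_ < _) wt G _)%N; lia.
Qed.

Lemma morph_connected : gconnected G -> gconnected G'.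
Proof.
move=> [nvG conG]; split.
  by have := leq_ltn_trans (leq0n _) (ltn_ord (gV (Ordinal nvG))).
move=> u' v'; have [u <-] := morph_surj u'; have [v <-] := morph_surj v'.
have /connectP [p pp ->] := conG u v.
elim: p u pp => //= x p IH u /andP[ux /IH]; apply: connect_trans.
have {ux} /existsP[e ux] := ux.
have [/codomP[e' ee]|/morph_contr ce] := boolP (e \in codom gE); last first.
  by case/orP: ux => /andP[/eqP <- /eqP <-]; rewrite ce connect0.
apply/connect1/existsP; exists e'.
case: (morph_ends e') => -[-> ->]; rewrite -ee; case/orP: ux => /andP[/eqP -> /eqP ->];
  by rewrite !eqxx ?orbT.
Qed.

Lemma cadj_sub_gadj u v : connect (cadj G (ne G') gE) u v -> connect (gadj G) u v.
Proof.
apply: connect_sub => x y /existsP[e /andP[_ xy]].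
by apply/connect1/existsP; exists e.
Qed.

(** Paths lift because the fibres are connected. It gives the connectedness of an expansion of [G]
    without looking at its edges. *)
Lemma morph_connected_rev : gconnected G' -> gconnected G.
Proof.
move=> [nvG conG]; split.
  by have [[i lti] _] := morph_surj (Ordinal nvG); apply: leq_ltn_trans lti.
move=> u v; have /connectP [p pp lastp] := conG (gV u) (gV v).
elim: p u pp lastp => [|x' p IH] u /=.
  by move=> _ /esym/morph_fiber/cadj_sub_gadj.
case/andP=> /existsP[e' ux] pp lastp.
have [x gx] : exists2 x, gV x = x' & connect (gadj G) u x.
  have E a b : (gV a = gV u) -> (a = src G (gE e') /\ b = tgt G (gE e')) \/
     (b = src G (gE e') /\ a = tgt G (gE e')) -> connect (gadj G) u b.
    move=> /esym/morph_fiber/cadj_sub_gadj ua ab; apply: connect_trans ua _.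
    apply/connect1/existsP; exists (gE e').
    by case: ab => -[-> ->]; rewrite !eqxx ?orbT.
  case: (morph_ends e') ux => -[-> ->] /orP[]/andP[/eqP ? /eqP ?].
  - exists (tgt G (gE e')) => //; apply: (E (src G (gE e'))) => //; by left.
  - exists (src G (gE e')) => //; apply: (E (tgt G (gE e'))) => //; by right.
  - exists (src G (gE e')) => //; apply: (E (tgt G (gE e'))) => //; by right.
  - exists (tgt G (gE e')) => //; apply: (E (src G (gE e'))) => //; by left.
by move=> ux2; apply: (connect_trans ux2); apply: IH; rewrite ?gx.
Qed.

Lemma morph_even : evenP G P -> evenP G' P'.
Proof.
move=> evP v'; have := morph_degP v'.
move/(congr1 odd); rewrite oddD mul2n odd_double addbF => <-.
by elim/big_rec: _ => // v n _; rewrite oddD (negbTE (evP v)).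
Qed.

End Morphisms.

Lemma morph_setT G G' P P' gV gE fl :
  is_morph G G' P P' gV gE fl -> is_morph G G' setT setT gV gE fl.
Proof.
by case=> a [b [c [d [f [h _]]]]]; do !split=> //; move=> e'; rewrite !inE.
Qed.

Lemma morph_deg G G' P P' gV gE fl v' : is_morph G G' P P' gV gE fl ->
  (\sum_(v | gV v == v') deg G v = deg G' v' +
     2 * #|[set e | (e \notin codom gE) && (gV (src G e) == v')]|)%N.
Proof.
move=> /morph_setT/morph_degP/(_ v').
under eq_bigr do rewrite -deg_degPT.
rewrite -deg_degPT => ->; congr (_ + 2 * _)%N.
by apply: eq_card => e; rewrite !inE.
Qed.

(** The quantity [2 wt - 2 + deg] is additive over fibres, and a fibre is nonempty, so a sum of
    positive terms bounds it below by 1. *)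
Lemma morph_stable G G' P P' gV gE fl : is_morph G G' P P' gV gE fl ->
  gstable G -> gstable G'.
Proof.
move=> gM stG v'.
have := morph_wt gM v'; have := morph_deg v' gM.
have [v0 gv0] := morph_surj gM v'.
have n_gt0 : (0 < #|[set v | gV v == v']|)%N.
  by apply/card_gt0P; exists v0; rewrite inE gv0.
have : (\sum_(v | gV v == v') (2 * wt G v + deg G v) >=
        \sum_(v | gV v == v') 3)%N by apply: leq_sum => v _; exact: stG.
rewrite sum_nat_const big_split -big_distrr /=.
rewrite (_ : #|[pred v | gV v == v']| = #|[set v | gV v == v']|); last first.
  by apply: eq_card => v; rewrite !inE.
move: n_gt0; set n := #|_|; set c := #|_|; set a := (\sum_(_ | _) wt G _)%N.
set d := (\sum_(_ | _) deg G _)%N.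
by move: (wt G' v') (deg G' v') => x y; lia.
Qed.

Lemma morph_valid g c c' gV gE fl :
  is_morph (cG c) (cG c') (cP c) (cP c') gV gE fl ->
  valid_cpair g c -> valid_cpair g c'.
Proof.
move=> gM [[conG [stG gG]] evP]; split; last exact: (morph_even gM).
split; first exact: (morph_connected gM).
by split; [exact: (morph_stable gM) | rewrite (morph_genus gM)].
Qed.

(** * Composition and factorization of contractions *)

Lemma codom_comp_inj (m n k : nat) (h : 'I_n -> 'I_k) (f : 'I_m -> 'I_n) x :
  injective h -> (h x \in codom (h \o f)) = (x \in codom f).
Proof.
move=> h_inj; apply/codomP/codomP => -[y].
  by move=> /h_inj ->; exists y.
by move=> ->; exists y.
Qed.

Lemma wtZ (w a c n : nat) : w%:Z = a%:Z + c%:Z - n%:Z + 1 <-> (w + n = a + c + 1)%N.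
Proof. by split; lia. Qed.

Section Compose.
Variables (G G' : wgraph) (P : {set 'I_(ne G)}) (P' : {set 'I_(ne G')}).
Variables (gV : 'I_(nv G) -> 'I_(nv G')) (gE : 'I_(ne G') -> 'I_(ne G)).
Variable fl : 'I_(ne G') -> bool.
Hypothesis gM : is_morph G G' P P' gV gE fl.

(** The second map is not assumed to satisfy the weight formula. Composition adds that formula as an
    input and gets it for the composite; factorization knows it for the composite and recovers it
    for the second map. *)
Lemma morph_wt_additive n m (dV : 'I_(nv G') -> 'I_n) (dE : 'I_m -> 'I_(ne G')) w :
  (forall e', e' \notin codom dE -> dV (src G' e') = dV (tgt G' e')) ->
  (\sum_(v' | dV v' == w) wt G' v'
     + #|[set e' | (e' \notin codom dE) && (dV (src G' e') == w)]|
     + #|[set v | dV (gV v) == w]| =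
   \sum_(v | dV (gV v) == w) wt G v
     + #|[set e | (e \notin codom (gE \o dE)) && (dV (gV (src G e)) == w)]|
     + #|[set v' | dV v' == w]|)%N.
Proof.
move=> dcontr.
have := eq_bigr _ (fun v' (_ : dV v' == w) => morph_wt gM v').
move/(_ 0%N addn (index_enum _)); rewrite !big_split /= sum1dep_card.
rewrite (sum_fibers gV dV w predT) /=.
under [X in (_ + X = _)%N]eq_bigr do rewrite -sum1dep_card.
rewrite (sum_fibers gV dV w predT (fun=> 1%N)) /= sum1dep_card.
under [X in (_ = _ + X + _)%N]eq_bigr do rewrite -sum1dep_card.
rewrite (sum_fibers (fun e => gV (src G e)) dV w (fun e => e \notin codom gE)) /=.
have -> : #|[set e | (e \notin codom (gE \o dE)) && (dV (gV (src G e)) == w)]|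
  = (\sum_(i | (i \notin codom gE) && (dV (gV (src G i)) == w)) 1 +
    #|[set e' | (e' \notin codom dE) && (dV (src G' e') == w)]|)%N.
  rewrite -!sum1dep_card (bigID (mem (codom gE))) /= addnC; congr addn.
    apply: eq_bigl => e; rewrite andbC andbA; congr andb; apply: andb_idr.
    by apply: contra => /codomP[x ->]; rewrite /= codom_f.
  rewrite (eq_bigl _ _ (fun=> andbC _ _)) sum_codom; last exact: (morph_inj gM).
  apply: eq_bigl => e'; rewrite codom_comp_inj; last exact: (morph_inj gM).
  apply: andb_id2l => /dcontr; case: (morph_ends gM e') => -[-> ->] //.
  by move=> ->.
set a := (\sum_(_ | _) wt G' _)%N; set b := (\sum_(_ | _) wt G _)%N.
set c := (\sum_(_ | _) 1)%N.
set d := #|[set v | dV (gV v) == w]|; set n' := #|[set v' | dV v' == w]|.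
by move: #|_| => c' H; rewrite addnAC H addnAC -!addnA (addnC c').
Qed.

Section Composition.
Variables (G2 : wgraph) (P2 : {set 'I_(ne G2)}).
Variables (dV : 'I_(nv G') -> 'I_(nv G2)) (dE : 'I_(ne G2) -> 'I_(ne G')).
Variable fl2 : 'I_(ne G2) -> bool.
Hypothesis dM : is_morph G' G2 P' P2 dV dE fl2.

Lemma morph_comp : is_morph G G2 P P2 (dV \o gV) (gE \o dE)
  (fun e => fl2 e (+) fl (dE e)).
Proof.
have contr e : e \notin codom (gE \o dE) -> dV (gV (src G e)) = dV (gV (tgt G e)).
  have [/codomP[e' ->]|/(morph_contr gM) -> //] := boolP (e \in codom gE).
  rewrite (codom_comp_inj _ _ (morph_inj gM)) => /(morph_contr dM).
  by case: (morph_ends gM e') => -[-> ->].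
split; first exact: inj_comp (morph_inj gM) (morph_inj dM).
split.
  move=> e /=; case: gM => _ [/(_ (dE e))]; case: dM => _ [/(_ e)].
  by case: (fl2 e); case: (fl (dE e)) => /= -[-> ->] _ [-> ->].
split; first exact: contr.
split.
  move=> v2; have [v' <-] := morph_surj dM v2; have [v <-] := morph_surj gM v'.
  by exists v.
split; last first.
  split; last by move=> e; rewrite (morph_P dM) (morph_P gM).
  move=> w; apply/wtZ; have := morph_wt_additive w (morph_contr dM).
  have := morph_wt dM w; set a := (\sum_(_ | _) wt G' _)%N.
  by set b := (\sum_(_ | _) wt G _)%N; rewrite /=; lia.
(* A contracted path in [G'] is lifted edge by edge; consecutive lifted edges need not share an end,
   and the gaps are filled inside fibres of [gV]. *)
have lift_conn u v : gV u = gV v -> connect (cadj G (ne G2) (gE \o dE)) u v.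
  move/(morph_fiber gM); apply: connect_sub => x y /existsP[e /andP[ce xy]].
  apply/connect1/existsP; exists e; rewrite xy andbT.
  by apply: contra ce => /codomP[z ->]; rewrite /= codom_f.
move=> u v /= /(morph_fiber dM) /connectP[p pp lastp].
elim: p u pp lastp => [|x' p IH] u /=; first by move=> _ /esym/lift_conn.
case/andP=> /existsP[e' /andP[ce ux]] pp lastp.
have ce' : gE e' \notin codom (gE \o dE).
  by rewrite codom_comp_inj //; apply: (morph_inj gM).
have step : connect (cadj G (ne G2) (gE \o dE)) (src G (gE e')) (tgt G (gE e')) /\
    connect (cadj G (ne G2) (gE \o dE)) (tgt G (gE e')) (src G (gE e')).
  by split; apply/connect1/existsP; exists (gE e'); rewrite ce' !eqxx ?orbT.
suff [x gx ux2] : exists2 x, gV x = x' & connect (cadj G (ne G2) (gE \o dE)) u x.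
  by apply: (connect_trans ux2); apply: IH; rewrite ?gx.
case: step => st ts.
case: (morph_ends gM e') ux => -[-> ->] /orP[]/andP[/eqP h1 /eqP h2].
- exists (tgt G (gE e')) => //; apply: connect_trans st; exact: lift_conn.
- exists (src G (gE e')) => //; apply: connect_trans ts; exact: lift_conn.
- exists (src G (gE e')) => //; apply: connect_trans ts; exact: lift_conn.
- exists (tgt G (gE e')) => //; apply: connect_trans st; exact: lift_conn.
Qed.
End Composition.

Section Factor.
Variables (G2 : wgraph) (P2 : {set 'I_(ne G2)}).
Variables (kV : 'I_(nv G) -> 'I_(nv G2)) (kE : 'I_(ne G2) -> 'I_(ne G)).
Variable fl2 : 'I_(ne G2) -> bool.
Hypothesis kM : is_morph G G2 P P2 kV kE fl2.

(** Every edge contracted by the first map is contracted by [kV], so [kV] is constant on the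
    connected fibres of [gV] and descends to [G']. *)
Lemma morph_factor : {subset codom kE <= codom gE} ->
  exists dV dE dfl, is_morph G' G2 P' P2 dV dE dfl /\ forall e, gE (dE e) = kE e.
Proof.
move=> sub.
have [dE dEK] : {dE | forall e, gE (dE e) = kE e}.
  by exists (fun e => iinv (sub _ (codom_f kE e))) => e; rewrite f_iinv.
(* The section [s] is arbitrary; [dVK] shows that the descended map does not depend on it. *)
have [s sK] := choice (morph_surj gM).
pose dV v' := kV (s v').
have dVK v : dV (gV v) = kV v.
  apply: (morph_connect_eq kM); have := morph_fiber gM (sK (gV v)).
  apply: connect_sub => x y /existsP[e /andP[ce xy]].
  apply/connect1/existsP; exists e; rewrite xy andbT.
  by apply: contra ce; apply: sub.
have codE e' : (e' \in codom dE) = (gE e' \in codom kE).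
  rewrite -(codom_comp_inj _ _ (morph_inj gM)).
  by apply/codomP/codomP => -[x /= ->]; exists x; rewrite /= dEK.
have codE2 e : (e \in codom (gE \o dE)) = (e \in codom kE).
  by apply/codomP/codomP => -[x /= ->]; exists x; rewrite /= dEK.
have contr e' : e' \notin codom dE -> dV (src G' e') = dV (tgt G' e').
  rewrite codE => /(morph_contr kM).
  by case: (morph_ends gM e') => -[-> ->]; rewrite !dVK.
exists dV, dE, (fun e => fl2 e (+) fl (dE e)); split=> //.
split; first by move=> x y xy; apply: (morph_inj kM); rewrite -!dEK xy.
split.
  move=> e /=; case: gM => _ [/(_ (dE e))]; case: kM => _ [/(_ e)].
  rewrite -dEK; case: (fl2 e); case: (fl (dE e)) => /= -[-> ->] _ [-> ->] _;
  by rewrite !dVK.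
split=> //; split.
  by move=> v2; have [v <-] := morph_surj kM v2; exists (gV v).
split; last first.
  split; last by move=> e; rewrite (morph_P gM) (morph_P kM) dEK.
  move=> w; apply/wtZ; have := morph_wt_additive w contr.
  have := morph_wt kM w.
  rewrite (eq_bigl _ _ (fun v => congr1 (eq_op^~ w) (dVK v))).
  rewrite (eq_card (B := [set v | kV v == w])); last by move=> v; rewrite !inE dVK.
  rewrite (eq_card (A := [set e | (e \notin codom (gE \o dE)) && _])
     (B := [set e | (e \notin codom kE) && (kV (src G e) == w)])); last first.
    by move=> e; rewrite !inE dVK codE2.
  set a := (\sum_(_ | _) wt G' _)%N.
  by set b := (\sum_(_ | _) wt G _)%N; rewrite /=; lia.
move=> u' v'; rewrite -[u']sK -[v']sK; move: (s u') (s v') => u v {u' v'}.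
rewrite !dVK => /(morph_fiber kM) /connectP[p pp ->] {v}.
elim: p u pp => //= x p IH u /andP[ux /IH]; apply: connect_trans.
have {ux} /existsP[e /andP[ce ux]] := ux.
have [/codomP[e' ee]|/(morph_contr gM) ge] := boolP (e \in codom gE); last first.
  by case/orP: ux => /andP[/eqP <- /eqP <-]; rewrite ge connect0.
apply/connect1/existsP; exists e'; rewrite codE -ee ce /=.
case: (morph_ends gM e') => -[-> ->]; rewrite -ee; case/orP: ux => /andP[/eqP -> /eqP ->];
  by rewrite !eqxx ?orbT.
Qed.
End Factor.
End Compose.

Lemma giso_morph G G' (P : {set 'I_(ne G)}) (P' : {set 'I_(ne G')}) phiV phiE fl : giso G G' phiV phiE fl ->
  (forall e, (phiE e \in P') = (e \in P)) ->
  exists psiE fl', [/\ is_morph G G' P P' phiV psiE fl', cancel phiE psiE &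
    cancel psiE phiE].
Proof.
move=> [[psiV psiVK phiVK] [[psiE psiEK phiEK] [wtE ends]]] PE.
exists psiE, (fl \o psiE); split=> //.
have cod e : e \in codom psiE by rewrite -[e]psiEK codom_f.
split; first exact: can_inj phiEK.
split.
  by move=> e' /=; have := ends (psiE e'); rewrite phiEK; case: (fl _).
split; first by move=> e; rewrite cod.
split; first by move=> v'; exists (psiV v').
split; first by move=> u v /(can_inj psiVK) ->.
split; last by move=> e'; rewrite -PE phiEK.
move=> v'; apply/wtZ.
rewrite (big_pred1 (psiV v')) ?/=; last first.
  by move=> v /=; rewrite -{1}[v']phiVK (can_eq psiVK).
rewrite -{1}[v']phiVK wtE (eq_card (B := [set psiV v'])); last first.
  by move=> v; rewrite !inE -{1}[v']phiVK (can_eq psiVK).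
rewrite cards1 eq_card0 ?addn0 // => e; by rewrite !inE cod.
Qed.

(** Fibres are connected through contracted edges; with none of these, the vertex map is
    injective. *)
Lemma morph_giso G G' P P' gV gE fl : is_morph G G' P P' gV gE fl ->
  (forall e, e \in codom gE) ->
  exists phiE fl', [/\ giso G G' gV phiE fl', cancel phiE gE, cancel gE phiE &
    forall e, (phiE e \in P') = (e \in P)].
Proof.
move=> gM cod.
pose phiE e := iinv (cod e).
have phiEK : cancel phiE gE by move=> e; rewrite f_iinv.
have gEK : cancel gE phiE by move=> e; apply: (morph_inj gM); rewrite phiEK.
have gVinj : injective gV.
  move=> u v /(morph_fiber gM) /connectP[[|x p] //= /andP[/existsP[e]]].
  by rewrite cod.
exists phiE, (fl \o phiE); split=> //; last first.
  by move=> e; rewrite (morph_P gM) phiEK.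
split.
  have [s sK] := choice (morph_surj gM).
  by exists s => // v; apply: gVinj; rewrite sK.
split; first by exists gE.
split; last first.
  move=> e /=; case: gM => _ [/(_ (phiE e))].
  by rewrite phiEK; case: (fl _) => -[-> ->].
move=> v; have := morph_wt gM (gV v).
rewrite (big_pred1 v) => [|u]; last by rewrite /= (inj_eq gVinj).
rewrite (eq_card (B := [set v])); last by move=> u; rewrite !inE (inj_eq gVinj).
rewrite cards1 (eq_card0 (A := [set e | _])); first by lia.
by move=> e; rewrite !inE cod.
Qed.

Lemma giso_id G : giso G G id id (fun=> false).
Proof. by split; [exists id | split; [exists id | split]]. Qed.

Lemma morph_id G P : is_morph G G P P id id (fun=> false).
Proof.
have [//|psiE [fl' [gM K1 K2]]] := @giso_morph _ _ P P _ _ _ (giso_id G).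
case: gM => a [b [c [d [f [h i]]]]]; split=> //; split=> //.
have cod (e : 'I_(ne G)) : e \in codom id by rewrite (codom_f id).
split; first by move=> e; rewrite cod.
split=> //; split; first by move=> u v ->.
split=> // v'; rewrite h.
have E e : (e \in codom psiE) = true by rewrite -[e]K1 codom_f.
by rewrite (eq_card (B := [set e | (e \notin codom id) && (src G e == v')])) // => e;
  rewrite !inE E cod.
Qed.

(** * Contracting and expanding edges *)

Lemma codom_lift n (h i : 'I_n.+1) : (i \in codom (lift h)) = (i != h).
Proof.
apply/codomP/idP => [[j ->]|]; first by rewrite eq_sym neq_lift.
by rewrite eq_sym => /unlift_some[j -> _]; exists j.
Qed.

Section SingleEdge.
Variables (G G' : wgraph) (P : {set 'I_(ne G)}) (P' : {set 'I_(ne G')}).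
Variables (gV : 'I_(nv G) -> 'I_(nv G')) (gE : 'I_(ne G') -> 'I_(ne G)).
Variable e0 : 'I_(ne G).

(** Serves both to contract an edge and to recognise an expansion. The weight grows by 1 exactly
    when the edge is a loop, since only a loop carries genus. *)
Lemma single_edge_morph :
  injective gE -> (forall e, (e \in codom gE) = (e != e0)) ->
  (forall e', src G' e' = gV (src G (gE e'))) ->
  (forall e', tgt G' e' = gV (tgt G (gE e'))) ->
  gV (src G e0) = gV (tgt G e0) ->
  (forall v', exists v, gV v = v') ->
  (forall u v, gV u = gV v -> [\/ u = v, (u = src G e0 /\ v = tgt G e0) |
                                  (u = tgt G e0 /\ v = src G e0)]) ->
  (forall v', wt G' v' = (\sum_(v | gV v == v') wt G v +
     ((gV (src G e0) == v') && (src G e0 == tgt G e0)))%N) ->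
  (forall e', (e' \in P') = (gE e' \in P)) ->
  is_morph G G' P P' gV gE (fun=> false).
Proof.
move=> gEinj cod srcE tgtE contr surj fib wtE PE; split=> //; split=> //.
split; first by move=> e; rewrite cod negbK => /eqP ->.
split=> //; split.
  move=> u v /fib [->|[-> ->]|[-> ->]]; first exact: connect0.
    by apply/connect1/existsP; exists e0; rewrite cod !eqxx.
  by apply/connect1/existsP; exists e0; rewrite cod !eqxx orbT.
split=> // v'; apply/wtZ; rewrite wtE.
have -> : #|[set e | (e \notin codom gE) && (gV (src G e) == v')]| =
          (gV (src G e0) == v') :> nat.
  case: (gV (src G e0) =P v') => [h|h].
    rewrite (eq_card (B := [set e0])) ?cards1 // => e; rewrite !inE cod negbK.
    by case: (e =P e0) => [->|]; rewrite // h eqxx.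
  rewrite eq_card0 // => e; rewrite !inE cod negbK.
  by case: (e =P e0) => // ->; apply/eqP.
(* The fibre over the image of [e0] has two vertices, or one if [e0] is a loop; every other fibre is
   a single vertex. *)
have -> : #|[set v | gV v == v']| = ((gV (src G e0) == v') && (src G e0 != tgt G e0)).+1.
  case: (gV (src G e0) =P v') => [h|h] /=.
    rewrite (eq_card (B := [set src G e0; tgt G e0])); last first.
      move=> v; rewrite !inE; apply/eqP/orP.
        by rewrite -h => /fib [->|[-> _]|[-> _]]; [left|left|right].
      by case=> /eqP ->; rewrite // -contr.
    by rewrite cards2.
  have [v gv] := surj v'.
  rewrite (eq_card (B := [set v])) ?cards1 // => u; rewrite !inE.
  apply/eqP/eqP => [|-> //]; rewrite -gv => /fib [//|[ue ve]|[ue ve]].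
    by case: h; rewrite -gv ve contr.
  by case: h; rewrite -gv ve.
by case: (gV (src G e0) =P v'); case: (src G e0 =P tgt G e0) => /= _ _; lia.
Qed.
End SingleEdge.

Lemma contract_edge (G : wgraph) (P : {set 'I_(ne G)}) (e0 : 'I_(ne G)) :
  exists G' P' gV gE fl, is_morph G G' P P' gV gE fl /\
    forall e, (e \in codom gE) = (e != e0).
Proof.
case: G P e0 => n [|m] s t w P e0; first by case: e0.
simpl in *; have [loop|nloop] := eqVneq (s e0) (t e0).
  exists (WGraph n m (s \o lift e0) (t \o lift e0)
    (fun v => w v + (s e0 == v))%N), [set e | lift e0 e \in P], id, (lift e0),
    (fun=> false); split; last by move=> e; rewrite codom_lift.
  apply: (@single_edge_morph (WGraph n m.+1 s t w) _ _ _ _ _ e0) => //=.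
  - exact: lift_inj.
  - by move=> e; rewrite codom_lift.
  - by move=> v; exists v.
  - by move=> u v ->; constructor.
  - by move=> v; rewrite big_pred1_eq loop eqxx andbT.
  - by move=> e; rewrite inE.
case: n s t w nloop => [|n] s t w nloop; first by case: (s e0).
have ts : t e0 != s e0 by rewrite eq_sym.
have [j0 sj0 _] := unlift_some ts.
(* The vertex [t e0] is deleted from the numbering and merged into [s e0], whose new index is
   [j0]. *)
pose r v := odflt j0 (unlift (t e0) v).
have rl j : r (lift (t e0) j) = j by rewrite /r liftK.
have rt : r (t e0) = j0 by rewrite /r unlift_none.
have rs : r (s e0) = j0 by rewrite sj0 rl.
have fib u v : r u = r v -> [\/ u = v, (u = s e0 /\ v = t e0) |
                                  (u = t e0 /\ v = s e0)].
  rewrite /r; case: (unliftP (t e0) u) => [j ->|->]; 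
  case: (unliftP (t e0) v) => [k ->|->] /=.
  - by move=> ->; constructor.
  - by move=> ->; constructor 2; rewrite -sj0.
  - by move=> <-; constructor 3; rewrite -sj0.
  - by move=> _; constructor.
exists (WGraph n m (r \o s \o lift e0) (r \o t \o lift e0)
    (fun v => \sum_(u | r u == v) w u)%N), [set e | lift e0 e \in P], r, (lift e0),
    (fun=> false); split; last by move=> e; rewrite codom_lift.
apply: (@single_edge_morph (WGraph n.+1 m.+1 s t w) _ _ _ _ _ e0) => //=.
- exact: lift_inj.
- by move=> e; rewrite codom_lift.
- by rewrite rs rt.
- by move=> v; exists (lift (t e0) v).
- by move=> v; rewrite (negbTE nloop) andbF addn0.
- by move=> e; rewrite inE.
Qed.

(** Edges are contracted one at a time: edges of [Z] that close a cycle have become loops when their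
    turn comes, and their genus goes into the weight. *)
Lemma contract_set (G : wgraph) (P : {set 'I_(ne G)}) (Z : {set 'I_(ne G)}) :
  exists G' P' gV gE fl, is_morph G G' P P' gV gE fl /\
    forall e, (e \in codom gE) = (e \notin Z).
Proof.
have [k leZ] := ubnP #|Z|; elim: k G P Z leZ => // k IH G P Z leZ.
have [->|[e0 e0Z]] := set_0Vmem Z.
  exists G, P, id, id, (fun=> false); split; first exact: morph_id.
  by move=> e; rewrite inE (codom_f id).
have [G1 [P1 [gV [gE [fl [gM cod]]]]]] := contract_edge P e0.
have [|G2 [P2 [dV [dE [fl2 [dM cod2]]]]]] := IH G1 P1 (gE @^-1: Z).
  rewrite -ltnS; apply: leq_trans leZ; rewrite ltnS (cardsD1 e0 Z) e0Z add1n ltnS.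
  rewrite -(card_imset _ (morph_inj gM)); apply/subset_leq_card/subsetP.
  move=> e /imsetP[x]; rewrite inE => xZ ->.
  by rewrite !inE xZ -cod codom_f.
exists G2, P2, (dV \o gV), (gE \o dE), (fun e => fl2 e (+) fl (dE e)).
split; first exact: (morph_comp gM dM).
move=> e; have [/codomP[e' ->]|ce] := boolP (e \in codom gE).
  by rewrite (codom_comp_inj _ _ (morph_inj gM)) cod2 inE.
have ee : e = e0 by apply/eqP; rewrite cod negbK in ce.
rewrite ee e0Z /=; apply/negbTE; rewrite -ee; apply: contra ce.
by move=> /codomP[x ->]; rewrite /= codom_f.
Qed.

(** * Expansions: pulling out a loop or splitting a vertex *)

Lemma expand_loop (G : wgraph) (P : {set 'I_(ne G)}) (v : 'I_(nv G)) g :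
  valid_cpair g (CPair G P) -> (0 < wt G v)%N ->
  exists G1 P1 gV gE fl, [/\ is_morph G1 G P1 P gV gE fl,
    valid_cpair g (CPair G1 P1) & exists e, e \notin codom gE].
Proof.
move=> [/= [conG [stG gG]] evP] wv.
pose ex e (a : 'I_(ne G) -> 'I_(nv G)) := if unlift ord_max e is Some j then a j else v.
(* One unit of weight at [v] is traded for a loop, which leaves [2 wt + deg], hence stability,
   unchanged. The loop stays outside [P1]. *)
pose G1 := WGraph (nv G) (ne G).+1 (fun e => ex e (src G)) (fun e => ex e (tgt G))
  (fun u => wt G u - (u == v))%N.
pose P1 : {set 'I_(ne G1)} := [set lift ord_max e | e in P].
have gM : is_morph G1 G P1 P id (lift ord_max) (fun=> false).
  apply: (@single_edge_morph G1 _ _ _ _ _ ord_max) => //=.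
  - exact: lift_inj.
  - by move=> e; rewrite codom_lift.
  - by move=> e; rewrite /ex liftK.
  - by move=> e; rewrite /ex liftK.
  - by rewrite /ex unlift_none.
  - by move=> u; exists u.
  - by move=> u w ->; constructor.
  - move=> u; rewrite big_pred1_eq /= /ex unlift_none eqxx andbT eq_sym.
    by case: (v =P u) => [<-|_]; rewrite ?addn1 ?subn1 ?prednK // subn0 addn0.
  - by move=> e; rewrite mem_imset //; apply: lift_inj.
exists G1, P1, id, (lift ord_max), (fun=> false); split=> //; last first.
  by exists ord_max; rewrite codom_lift eqxx.
have degP1 (Q : {set 'I_(ne G1)}) u :
    (degP G1 Q u = degP G [set e | lift ord_max e \in Q] u
      + (ord_max \in Q) * (v == u).*2)%N.
  rewrite !degPE [in LHS]big_mkcond (bigD1_ord ord_max) //= addnC; congr addn.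
    rewrite big_mkcond [in RHS]big_mkcond; apply: eq_bigr => e _ /=.
    by rewrite inE /ex liftK.
  by rewrite /ex unlift_none; case: (_ \in Q); rewrite ?mul1n ?addnn.
split; first split=> /=; first exact: (morph_connected_rev gM).
  split; last by rewrite -(morph_genus gM).
  move=> u; have := stG u; rewrite !deg_degPT degP1 /= inE mul1n.
  rewrite (_ : [set e | _] = [set: 'I_(ne G)]); last by apply/setP => e; rewrite !inE.
  move: wv; rewrite eq_sym; case: (v =P u) => [<-|_]; lia.
move=> u /=; rewrite degP1 oddD oddM odd_double andbF addbF.
rewrite (_ : [set e | _] = P) ?evP //; apply/setP => e.
by rewrite inE mem_imset //; apply: lift_inj.
Qed.

Lemma exists_subset_card (T : finType) (S : {set T}) k : (k <= #|S|)%N ->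
  exists2 A : {set T}, A \subset S & #|A| = k.
Proof.
move=> leS; exists [set x in take k (enum S)].
  by apply/subsetP => x; rewrite inE => /mem_take; rewrite mem_enum.
rewrite cardsE (card_uniqP _) ?take_uniq ?enum_uniq //.
by rewrite size_takel // -cardE.
Qed.

(** Two of the half-edges at [v] are moved to a new weightless vertex, joined to [v] by a new edge.
    The new vertex is trivalent, and [v] keeps valence at least 4 - 2 + 1 = 3. *)
Lemma expand_vertex (G : wgraph) (P : {set 'I_(ne G)}) (v : 'I_(nv G)) g :
  valid_cpair g (CPair G P) -> (3 < deg G v)%N ->
  exists G1 P1 gV gE fl, [/\ is_morph G1 G P1 P gV gE fl,
    valid_cpair g (CPair G1 P1) & exists e, e \notin codom gE].
Proof.
move=> [/= [conG [stG gG]] evP] dv.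
(* The moved half-edges are the source ends of [A] and the target ends of [B]. Treating the two ends
   separately allows a loop to move by one end only or by both. *)
have [A [B [AS BT cAB]]] : exists A B : {set 'I_(ne G)},
   [/\ A \subset [set e | src G e == v], B \subset [set e | tgt G e == v] &
       (#|A| + #|B| = 2)%N].
  have [A AS cA] := exists_subset_card (geq_minr 2 #|[set e | src G e == v]|).
  have [|B BT cB] := @exists_subset_card _ [set e | tgt G e == v] (2 - #|A|).
    by move: dv; rewrite cA /deg; lia.
  by exists A, B; split=> //; rewrite cB subnKC // cA geq_minl.
have inA e : e \in A -> src G e = v.
  by move/(subsetP AS); rewrite inE => /eqP.
have inB e : e \in B -> tgt G e = v.
  by move/(subsetP BT); rewrite inE => /eqP.
pose v2 : 'I_(nv G).+1 := ord_max.
pose lv : 'I_(nv G) -> 'I_(nv G).+1 := lift ord_max.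
have lv_inj : injective lv by exact: lift_inj.
have v2lv u : (v2 == lv u) = false by apply/negbTE; rewrite neq_lift.
pose r (u : 'I_(nv G).+1) := odflt v (unlift ord_max u).
have rl u : r (lv u) = u by rewrite /r liftK.
have rv2 : r v2 = v by rewrite /r unlift_none.
pose ex e (S : {set 'I_(ne G)}) (a : 'I_(ne G) -> 'I_(nv G)) d :=
  if unlift ord_max e is Some j then if j \in S then v2 else lv (a j) else d.
pose G1 := WGraph (nv G).+1 (ne G).+1 (fun e => ex e A (src G) (lv v))
  (fun e => ex e B (tgt G) v2)
  (fun u => if unlift ord_max u is Some u' then wt G u' else 0%N).
(* The new edge joins [P1] exactly when an odd number of half-edges of [P] was moved, which makes
   the degree at [v2] even. *)
pose b := odd (#|A :&: P| + #|B :&: P|).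
pose P1 : {set 'I_(ne G1)} := [set e | if unlift ord_max e is Some j then j \in P else b].
have rfib u : forall w, (r w == u) = (w == lv u) || ((w == v2) && (v == u)).
  move=> w; case: (unliftP ord_max w) => [j ->|->].
    by rewrite -/(lv j) rl (inj_eq lv_inj) [lv j == v2]eq_sym v2lv orbF.
  by rewrite -/v2 rv2 v2lv eqxx.
have gM : is_morph G1 G P1 P r (lift ord_max) (fun=> false).
  apply: (@single_edge_morph G1 _ _ _ _ _ ord_max) => //=.
  - exact: lift_inj.
  - by move=> e; rewrite codom_lift.
  - move=> e; rewrite /ex liftK; case: ifP => [/inA ->|]; by rewrite ?rv2 ?rl.
  - move=> e; rewrite /ex liftK; case: ifP => [/inB ->|]; by rewrite ?rv2 ?rl.
  - by rewrite /ex unlift_none rl rv2.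
  - by move=> u; exists (lv u).
  - rewrite /ex unlift_none => u w /eqP; rewrite rfib.
    case: (unliftP ord_max w) => [j ->|->]; rewrite -/v2 -?/(lv _).
      rewrite rl => /orP[/eqP ->|/andP[/eqP -> /eqP ->]]; first by constructor.
      by constructor 3.
    rewrite rv2 => /orP[/eqP ->|/andP[/eqP -> _]]; last by constructor.
    by constructor 2.
  - move=> u; rewrite /ex unlift_none rl [lv v == v2]eq_sym v2lv andbF addn0.
    rewrite (bigD1 (lv u)) ?rl //= liftK big1 ?addn0 // => w /andP[].
    by rewrite rfib => /orP[->|/andP[/eqP -> _]] //; rewrite unlift_none.
  - by move=> e; rewrite inE liftK.
exists G1, P1, r, (lift ord_max), (fun=> false); split=> //; last first.
  by exists ord_max; rewrite codom_lift eqxx.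
have degP_v2 (Q : {set 'I_(ne G1)}) : degP G1 Q v2 =
   (#|A :&: [set e | lift ord_max e \in Q]| +
    #|B :&: [set e | lift ord_max e \in Q]| + (ord_max \in Q))%N.
  rewrite degPE big_mkcond (bigD1_ord ord_max) //= addnC; congr addn; last first.
    by rewrite /ex unlift_none eqxx [lv v == v2]eq_sym v2lv.
  rewrite -!sum1_card 2![\sum_(_ in _ :&: _) _]big_mkcond -big_split /=.
  apply: eq_bigr => e _; rewrite !inE /ex liftK.
  have E (S : {set 'I_(ne G)}) x : ((if e \in S then v2 else lv x) == v2) = (e \in S).
    by case: ifP; rewrite ?eqxx // eq_sym v2lv.
  by rewrite !E; case: (_ \in Q); case: (_ \in A); case: (_ \in B).
have degP_lv (Q : {set 'I_(ne G1)}) u : v != u ->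
    degP G1 Q (lv u) = degP G [set e | lift ord_max e \in Q] u.
  move=> uv; rewrite !degPE big_mkcond (bigD1_ord ord_max) //=.
  rewrite /ex unlift_none (inj_eq lv_inj) (negbTE uv) v2lv if_same add0n.
  rewrite [RHS]big_mkcond; apply: eq_bigr => e _ /=; rewrite inE liftK.
  have E (S : {set 'I_(ne G)}) x : (e \in S -> x = v) ->
     ((if e \in S then v2 else lv x) == lv u) = (x == u).
    by case: ifP => [_ ->|_ _]; rewrite // ?v2lv ?(negbTE uv) ?(inj_eq lv_inj).
  by rewrite !E //; [apply: inB | apply: inA].
have fib_sum (F : 'I_(nv G1) -> nat) : (\sum_(w | r w == v) F w = F (lv v) + F v2)%N.
  rewrite (bigD1 (lv v)) ?rl //= (bigD1 v2) ?rv2 ?eqxx ?v2lv //=.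
  rewrite big1 ?addn0 // => w; rewrite rfib eqxx andbT.
  by case/andP=> /andP[/orP[]->].
have P1E : [set e | lift ord_max e \in P1] = P.
  by apply/setP => e; rewrite !inE liftK.
have TE : [set e | lift ord_max e \in [set: 'I_(ne G1)]] = [set: 'I_(ne G)].
  by apply/setP => e; rewrite !inE.
split; first split=> /=; first exact: (morph_connected_rev gM).
  split; last by rewrite -(morph_genus gM).
  have dv2 : deg G1 v2 = 3.
    by rewrite deg_degPT degP_v2 TE !setIT inE cAB.
  move=> u; case: (unliftP ord_max u) => [j ->|->]; last by rewrite -/v2 dv2; lia.
  rewrite -/(lv j) {1}/wt /= liftK.
  have [vj|vj] := eqVneq v j; last first.
    by have := stG j; rewrite !deg_degPT degP_lv // TE.
  (* The new edge is contracted into the fibre of [v], so the fibre count bounds the remaining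
     degree of [v] from below. *)
  have := morph_deg v gM; rewrite fib_sum dv2 -vj.
  have : (0 < #|[set e | (e \notin codom (lift (@ord_max (ne G)))) &&
                (r (src G1 e) == v)]|)%N.
    apply/card_gt0P; exists ord_max; rewrite inE codom_lift eqxx /=.
    by rewrite /ex unlift_none rl.
  by move: dv; set c := #|_|; lia.
have even_v2 : ~~ odd (degP G1 P1 v2).
  by rewrite degP_v2 P1E inE unlift_none oddD -/b oddb addbb.
move=> u /=; case: (unliftP ord_max u) => [j ->|-> //]; rewrite -/(lv j).
have [<-|vj] := eqVneq v j; last by rewrite degP_lv // P1E evP.
(* The parity at the old vertex follows from those at [v2] and at [v] in [G], since the total degree
   over the fibre changes by an even number. *)
have := morph_degP gM v; rewrite fib_sum => /(congr1 odd).
by rewrite oddD [in RHS]oddD oddM addbF (negbTE even_v2) addbF => ->; exact: evP.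
Qed.

(** * Dimension count from the degree [2 g - 2] of the canonical divisor *)

Lemma sum_stability (G : wgraph) g : sgraph g G ->
  (\sum_v (2 * wt G v + deg G v) + 2 = 2 * g + 2 * nv G)%N.
Proof.
move=> [_ [_ gG]].
have dE : (\sum_v deg G v = 2 * ne G)%N.
  under eq_bigr do rewrite deg_degPT degPE.
  rewrite exchange_big /= (eq_bigr (fun=> 2%N)); last first.
    move=> e _; have one (x : 'I_(nv G)) : (\sum_v (x == v) = 1)%N.
      rewrite (bigD1 x) //= eqxx big1 // => v; by rewrite eq_sym => /negbTE ->.
    by rewrite big_split /= !one.
  by rewrite sum_nat_const cardsT card_ord mulnC.
rewrite big_split -big_distrr /= dE; move: gG; rewrite /genus.
by set a := (\sum_(_ < _) _)%N; lia.
Qed.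

(** Each vertex contributes at least 1 to [2 g - 2], so there are at most [2 g - 2] vertices, and
    the genus formula bounds the edges by [3 g - 3]. *)
Lemma ne_le g G : sgraph g G -> (ne G <= 3 * g - 3)%N.
Proof.
move=> sG; have := sum_stability sG; case: (sG) => _ [stG gG].
have : (\sum_(v < nv G) 3 <= \sum_v (2 * wt G v + deg G v))%N.
  by apply: leq_sum => v _; exact: stG.
rewrite sum_nat_const card_ord; move: gG; rewrite /genus.
set a := (\sum_(_ < _) wt _ _)%N; set b := (\sum_(_ < _) (_ + _))%N; lia.
Qed.

(** If neither expansion applies, the graph is weightless and trivalent; then it has [2 g - 2]
    vertices and therefore [3 g - 3] edges. *)
Lemma expand g c : valid_cpair g c -> ne (cG c) <> (3 * g - 3)%N ->
  exists c1 gV gE fl, [/\ is_morph (cG c1) (cG c) (cP c1) (cP c) gV gE fl,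
    valid_cpair g c1 & exists e, e \notin codom gE].
Proof.
case: c => G P vc nE.
suff [G1 [P1 [gV [gE [fl H]]]]] : exists G1 P1 gV gE fl,
    [/\ is_morph G1 G P1 P gV gE fl,
    valid_cpair g (CPair G1 P1) & exists e, e \notin codom gE].
  by exists (CPair G1 P1), gV, gE, fl.
have [/existsP[v wv]|/existsPn w0] := boolP [exists v, 0 < wt G v]%N.
  exact: (expand_loop vc wv).
have [/existsP[v dv]|/existsPn d3] := boolP [exists v, 3 < deg G v]%N.
  exact: (expand_vertex vc dv).
case: nE => /=; have [/= sG _] := vc; have := sum_stability sG.
case: sG => _ [stG]; rewrite /genus big1 => [|v _]; last first.
  by have := w0 v; lia.
rewrite (eq_bigr (fun=> 3%N)) => [|v _]; last first.
  by have := w0 v; have := d3 v; have := stG v; lia.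
rewrite sum_nat_const card_ord; lia.
Qed.

Definition point_graph (g : nat) : wgraph :=
  WGraph 1 0 (fun e => ord0) (fun e => ord0) (fun=> g).

Lemma point_graph_valid g : (2 <= g)%N -> valid_cpair g (CPair (point_graph g) set0).
Proof.
move=> hg; split; last by move=> v; rewrite degPE big1 // => -[].
split=> /=; first by split=> // u v; rewrite !ord1.
by split; [move=> v /=; lia | rewrite /genus big_ord1 /=; lia].
Qed.

Lemma exists_top g : (2 <= g)%N ->
  exists c, valid_cpair g c /\ ne (cG c) = (3 * g - 3)%N.
Proof.
move=> hg.
suff : forall k c, valid_cpair g c -> (3 * g - 3 - ne (cG c) < k)%N ->
   exists c, valid_cpair g c /\ ne (cG c) = (3 * g - 3)%N.
  by move/(_ _ _ (point_graph_valid hg)); apply; apply: ltnSn.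
elim=> // k IH c vc lek.
have [?|/eqP nE] := eqVneq (ne (cG c)) (3 * g - 3)%N; first by exists c.
have [c1 [gV [gE [fl [gM vc1 [e ce]]]]]] := expand vc nE.
apply: (IH c1) => //.
have : (ne (cG c) < ne (cG c1))%N.
  rewrite -[X in (X < _)%N]card_ord -[X in (_ < X)%N]card_ord.
  rewrite -(card_codom (morph_inj gM)); apply: proper_card.
  by apply/properP; split; [apply/subsetP | exists e].
have := ne_le vc1.1; lia.
Qed.

(** * The colimit *)

Section Colimit.
Variables (R : realType) (g : nat).
Notation cpt := (cpt R).
Notation CPt := (CPt R).
Notation Ttrop := (Ttrop R g).
Notation ceq := (ceq R g).

(** With [vanish] set, the contraction maps [p] to a positive vector representing the same point.
    Without it, the contracted coordinates are free, and the condition is open in [p] when [O] is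
    open. *)
Definition contracts_to (vanish : bool) (c : cpair)
    (O : ('I_(ne (cG c)) -> R) -> Prop) (p : cpt) : Prop :=
  exists gV gE fl, [/\ is_morph (cG (ci R p)) (cG c) (cP (ci R p)) (cP c) gV gE fl,
    (forall e, 0 < cx R p (gE e)), O (fun e => cx R p (gE e)) &
    vanish -> forall e, e \notin codom gE -> cx R p e = 0].

(** From [q] to [p], contractions are composed. From [p] to [q], the edges kept by the contraction
    have positive coordinates, hence are not contracted by the step, and this is the hypothesis of
    [morph_factor]. *)
Lemma contracts_to_step vanish c O p q : cstep R g p q ->
  contracts_to vanish (c := c) O p <-> contracts_to vanish O q.
Proof.
move=> [_ [_ [dV [dE [fl [dM [dx d0]]]]]]]; split; last first.
  move=> [gV [gE [fl2 [gM pos OE van]]]].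
  have gEE : (fun e => cx R p (dE (gE e))) = (fun e => cx R q (gE e)).
    by apply/funext => e; rewrite dx.
  exists (gV \o dV), (dE \o gE), (fun e => fl2 e (+) fl (gE e)); split.
  - exact: (morph_comp dM gM).
  - by move=> e /=; rewrite dx.
  - by rewrite /comp gEE.
  - move=> v e; have [/codomP[e' ->]|/d0 //] := boolP (e \in codom dE).
    by rewrite (codom_comp_inj _ _ (morph_inj dM)) dx; apply: van.
move=> [gV [gE [fl2 [gM pos OE van]]]].
have sub : {subset codom gE <= codom dE}.
  move=> _ /codomP[e ->]; apply: contraT => /d0 e0.
  by have := pos e; rewrite e0 ltxx.
have [hV [hE [fl3 [hM hEK]]]] := morph_factor dM gM sub.
have gEE : (fun e => cx R p (gE e)) = (fun e => cx R q (hE e)).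
  by apply/funext => e; rewrite -dx hEK.
exists hV, hE, fl3; split=> //.
- by move=> e; rewrite -dx hEK.
- by rewrite -gEE.
- move=> v e he; rewrite -dx; apply: van => //; apply: contra he => /codomP[z].
  by rewrite -hEK => /(morph_inj dM) ->; rewrite codom_f.
Qed.

Lemma contracts_to_ceq vanish c O p q : ceq p q ->
  contracts_to vanish (c := c) O p <-> contracts_to vanish O q.
Proof.
elim=> {p q} [p q /contracts_to_step//|//|p q _ IH|p q r _ IH _ IH2].
  exact: iff_sym.
exact: iff_trans IH IH2.
Qed.

Lemma ceq_sym p q : ceq p q -> ceq q p. Proof. exact: rst_sym. Qed.

Lemma ceq_trans p q r : ceq p q -> ceq q r -> ceq p r. Proof. exact: rst_trans. Qed.

Lemma ceq_valid p q : ceq p q -> valid_cpt R g p <-> valid_cpt R g q.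
Proof.
elim=> {p q} [p q [vp [vq _]]|//|p q _ IH|p q r _ IH _ IH2].
- by split.
- exact: iff_sym.
- exact: iff_trans IH IH2.
Qed.

Lemma valid_pos c l : valid_cpair g c -> (forall e, 0 < l e) -> valid_cpt R g (CPt c l).
Proof. by move=> vc l0; split=> // e; apply/ltW/l0. Qed.

(** Any zigzag ending at a positive vector collapses to a single face map. *)
Lemma cstep_pos p c l : (forall e, 0 < l e) -> valid_cpt R g p ->
  ceq p (CPt c l) -> cstep R g p (CPt c l).
Proof.
move=> l0 vp pc; split=> //; split; first by apply/(ceq_valid pc).
(* With [O] the singleton of [l], the predicate holds trivially at the end of the zigzag; carried
   back to [p], it is the required step. *)
have /(contracts_to_ceq _ _ pc) : contracts_to true (c := c) (eq l) (CPt c l).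
  exists id, id, (fun=> false); split=> //=; first exact: morph_id.
  by move=> _ e; rewrite (codom_f id).
move=> [gV [gE [fl [gM pos lE van]]]]; exists gV, gE, fl; split=> //; split.
  by move=> e /=; rewrite lE.
exact: van.
Qed.

Lemma ceq_giso c l c' l' : valid_cpair g c ->
  (forall e, 0 < l e) -> (forall e, 0 < l' e) ->
  ceq (CPt c l) (CPt c' l') ->
  exists phiV phiE fl, [/\ giso (cG c) (cG c') phiV phiE fl,
    forall e, (phiE e \in cP c') = (e \in cP c) & forall e, l' (phiE e) = l e].
Proof.
move=> vc l0 l0' /(cstep_pos l0' (valid_pos vc l0)).
move=> [_ [_ [gV [gE [fl [gM [lE van]]]]]]].
have cod e : e \in codom gE.
  by apply: contraT => /van /= e0; have := l0 e; rewrite e0 ltxx.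
have [phiE [fl' [iso phiEK _ PE]]] := morph_giso gM cod.
by exists gV, phiE, fl'; split=> // e; have /= := lE (phiE e); rewrite phiEK.
Qed.

Lemma giso_ceq c l c' l' phiV phiE fl : valid_cpair g c -> valid_cpair g c' ->
  (forall e, 0 < l e) -> giso (cG c) (cG c') phiV phiE fl ->
  (forall e, (phiE e \in cP c') = (e \in cP c)) -> (forall e, l' (phiE e) = l e) ->
  ceq (CPt c l) (CPt c' l').
Proof.
move=> vc vc' l0 iso PE lE; have [psiE [fl' [gM K1 K2]]] := giso_morph iso PE.
apply: rst_step; split; first exact: valid_pos.
split; first by apply: valid_pos => // e; rewrite -[e]K2 lE.
exists phiV, psiE, fl'; split=> //; split; first by move=> e /=; rewrite -lE K2.
by move=> e; rewrite -[e]K1 codom_f.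
Qed.

(** Exactly the edges with coordinate zero are contracted. *)
Lemma normal_form p : valid_cpt R g p ->
  exists c l, [/\ valid_cpair g c, forall e, 0 < l e & ceq p (CPt c l)].
Proof.
move=> vp; have [G' [P' [gV [gE [fl [gM cod]]]]]] :=
  contract_set (cP (ci R p)) [set e | cx R p e == 0].
have vc : valid_cpair g (CPair G' P') by apply: (@morph_valid _ _ (CPair G' P') _ _ _ gM vp.1).
have l0 e : 0 < cx R p (gE e).
  by rewrite lt_neqAle vp.2 andbT eq_sym; have := cod (gE e); rewrite codom_f inE => /esym.
exists (CPair G' P'), (fun e => cx R p (gE e)); split=> //.
apply: rst_step; split=> //; split; first exact: valid_pos.
exists gV, gE, fl; split=> //; split=> // e.
by rewrite cod negbK inE => /eqP.
Qed.

Lemma class_valid (x : Ttrop) p : sval x p -> valid_cpt R g p.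
Proof. by case: x => C /= [q [vq ->]] /ceq_valid <-. Qed.

Lemma class_ceq (x : Ttrop) p q : sval x p -> sval x q <-> ceq p q.
Proof.
case: x => C /= [r [vr ->]] rp; split=> [|pq]; last exact: ceq_trans pq.
by move=> rq; apply: ceq_trans rq; apply: ceq_sym.
Qed.

Lemma class_exists p : valid_cpt R g p -> exists x : Ttrop, sval x p.
Proof.
move=> vp; have H : exists q, valid_cpt R g q /\ ceq p = ceq q by exists p.
by exists (exist _ (ceq p) H); apply: rst_refl.
Qed.

Lemma class_inhabited (x : Ttrop) : exists p, sval x p.
Proof. by case: x => C /= [p [vp ->]]; exists p; apply: rst_refl. Qed.

Lemma class_inj (x y : Ttrop) p : sval x p -> sval y p -> x = y.
Proof.
move=> xp yp; have : sval x = sval y.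
  by apply/funext => q; apply/propext; rewrite (class_ceq _ xp) (class_ceq _ yp).
case: x y {xp yp} => C HC [D HD] /= E; case: _ / E HD => HD.
by congr exist; apply: Prop_irrelevance.
Qed.

Lemma class_normal_form (x : Ttrop) :
  exists c l, [/\ valid_cpair g c, forall e, 0 < l e & sval x (CPt c l)].
Proof.
have [p xp] := class_inhabited x.
have [c [l [vc l0 pc]]] := normal_form (class_valid xp).
by exists c, l; split=> //; apply/(class_ceq _ xp).
Qed.

(** * Open stars, the topology of strata and their closures *)

Definition open_set (n : nat) (O : ('I_n -> R) -> Prop) : Prop :=
  forall l, O l -> (forall e, 0 < l e) /\
    exists2 eps : R, 0 < eps & forall l', (forall e, 0 < l' e) ->
      (forall e, `|l' e - l e| < eps) -> O l'.

Definition star c (O : ('I_(ne (cG c)) -> R) -> Prop) (x : Ttrop) : Prop :=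
  exists p, sval x p /\ contracts_to false O p.

Lemma starP c O (x : Ttrop) p : sval x p -> star (c := c) O x <-> contracts_to false O p.
Proof.
move=> xp; split=> [[q [xq Oq]]|]; last by exists p.
have pq : ceq p q by apply/(class_ceq q xp).
by apply/(contracts_to_ceq _ _ pq).
Qed.

Lemma common_lower_bound n (f : 'I_n -> R) : (forall i, 0 < f i) ->
  exists2 d, 0 < d & forall i, d <= f i.
Proof.
move=> f0; exists (\big[Num.min/1]_i f i).
  by elim/big_ind: _ => // x y x0 y0; rewrite lt_min x0.
by move=> i; apply: bigmin_le_cond.
Qed.

(** Openness is tested at every representative, including boundary points: a small move keeps the
    finitely many kept coordinates positive and in [O], whatever happens to the others. *)
Lemma star_open c O : open_set O -> open_T R g (star (c := c) O).
Proof.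
move=> Oop p vp [x [/starP Ox xp]].
have {Ox} [gV [gE [fl [gM pos OE _]]]] := Ox _ xp.
have [_ [eps eps0 Oeps]] := Oop _ OE.
have [d d0 led] := common_lower_bound pos.
exists (Num.min eps d); first by rewrite lt_min eps0.
move=> y y0 near.
have [|x' x'y] := @class_exists (CPt (ci R p) y); first by case: vp.
exists x'; split=> //; apply/(starP _ x'y).
have ypos e : 0 < y (gE e).
  have := near (gE e); rewrite lt_min => /andP[_].
  by rewrite ltr_distl => /andP[h _]; have := led e; lra.
exists gV, gE, fl; split=> //=; apply: Oeps => // e.
by have := near (gE e); rewrite lt_min => /andP[].
Qed.

(** Images of open subsets of the open cone are traces of open sets, so the stratum carries the
    quotient topology. A contraction of [(G, P)] to itself keeps all edges, an injection of a finite
    set into itself being onto, so only automorphisms intervene. *)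
Lemma stratum_star c O (x : Ttrop) : valid_cpair g c -> open_set O ->
  (stratum R g c x /\ star O x) <-> exists l, O l /\ sval x (CPt c l).
Proof.
move=> vc Oop; split; last first.
  move=> [l [Ol xl]]; have [l0 _] := Oop _ Ol; split; first by exists l.
  exists (CPt c l); split=> //; exists id, id, (fun=> false); split=> //.
  exact: morph_id.
move=> [[l [l0 xl]] /(starP _ xl) [gV [gE [fl [gM pos OE _]]]]].
exists (fun e => l (gE e)); split=> //; apply/(class_ceq _ xl).
apply: rst_step; split; first exact: valid_pos.
split; first exact: valid_pos.
exists gV, gE, fl; split=> //; split=> // e.
have : codom gE =i predT.
  by apply/(inj_card_onto (morph_inj gM)).
by move=> ->.
Qed.

(** One direction tests closure against the open star of the smaller stratum: a point of the larger
    stratum in it provides the contraction. The other pushes a point of the face into the open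
    cone. *)
Lemma stratum_ge c c' : valid_cpair g c -> valid_cpair g c' ->
  (forall x, stratum R g c' x -> closure_T R g (stratum R g c) x) <-> cge c c'.
Proof.
move=> vc vc'; split.
  move=> H; pose O (l : 'I_(ne (cG c')) -> R) := forall e, 0 < l e.
  have Oop : open_set O by move=> l Ol; split=> //; exists 1.
  have [x xc'] := class_exists (valid_pos (l := fun=> 1) vc' (fun=> ltr01)).
  have xst : stratum R g c' x by exists (fun=> 1).
  have xO : star O x.
    apply/(starP _ xc'); exists id, id, (fun=> false); split=> //=.
    exact: morph_id.
  have [x' [/starP Ox' [l [l0 x'l]]]] := H x xst _ (star_open Oop) xO.
  by have [gV [gE [fl [gM _ _ _]]]] := Ox' _ x'l; exists gV, gE, fl.
move=> [gV [gE [fl gM]]] x [l [l0 xl]] U Uop Ux.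
(* The face inclusion: [l] extended by zero on the contracted edges. *)
pose y e := if [pick e' | gE e' == e] is Some e' then l e' else 0.
have y0 e : 0 <= y e by rewrite /y; case: pickP => // e' _; apply/ltW.
have yE e' : y (gE e') = l e'.
  rewrite /y; case: pickP => [e2 /eqP/(morph_inj gM) -> //|/(_ e')].
  by rewrite eqxx.
have vy : valid_cpt R g (CPt c y) by [].
have xy : sval x (CPt c y).
  apply/(class_ceq _ xl)/ceq_sym/rst_step; split=> //.
  split; first exact: valid_pos.
  exists gV, gE, fl; split=> //; split=> // e ce /=; rewrite /y.
  by case: pickP => // e' /eqP ee; rewrite -ee codom_f in ce.
have [|eps eps0 near] := Uop _ vy; first by exists x.
(* Adding [eps / 2] to all coordinates makes them positive without leaving the neighbourhood. *)
have [|e|x' [Ux' x'y]] := near (fun e => y e + eps / 2).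
- by move=> e; have := y0 e; lra.
- by rewrite /= addrAC subrr add0r gtr0_norm; lra.
exists x'; split=> //; exists (fun e => y e + eps / 2); split=> // e.
by have := y0 e; lra.
Qed.

(** * Connectedness through the common apex *)

Lemma ceq_apex c : (2 <= g)%N -> valid_cpair g c ->
  ceq (CPt c (fun=> 0)) (CPt (CPair (point_graph g) set0) (fun=> 0)).
Proof.
move=> hg vc; apply: rst_step; split; first by split.
split; first by split=> //; apply: point_graph_valid.
pose gE (e : 'I_0) : 'I_(ne (cG c)) := match (e : 'I_0) with Ordinal _ h => False_rect _ (elimF idP (ltn0 _) h) end.
have cod e : (e \in codom gE) = false by apply/negP => /codomP[[]].
exists (fun=> ord0), gE, (fun=> false); split=> //=.
have [[[nvG conG] [stG gG]] evP] := vc.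
split; first by move=> [].
split; first by move=> [].
split=> //; split; first by move=> v; exists (Ordinal nvG); apply/esym/(ord1 (v : 'I_1)).
split; last first.
  split; last by move=> [].
  (* The only fibre is the whole graph, so the weight formula becomes the definition of the
     genus. *)
  move=> v; have -> : v = ord0 := ord1 (v : 'I_1); rewrite /= -gG /genus.
  congr (_%:Z + _%:Z - _%:Z + 1).
    by rewrite -[LHS]card_ord; apply: eq_card => e; rewrite !inE cod.
  by rewrite -[LHS]card_ord; apply: eq_card => e; rewrite !inE.
move=> u v _; apply: connect_sub (conG u v) => a b /existsP[e ab].
by apply/connect1/existsP; exists e; rewrite cod.
Qed.

(** Take the supremum of the [t] such that [A] holds on [[0, t]]. If it lies in [A], the interval
    extends further, or reaches 1 where [B] holds; if it lies in [B], points just below it lie in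
    both. *)
Lemma segment_connected (A B : R -> Prop) :
  (forall t : R, 0 <= t <= 1 -> A t \/ B t) ->
  (forall t : R, 0 <= t <= 1 -> A t ->
     exists2 d : R, 0 < d & forall s : R, 0 <= s <= 1 -> `|s - t| < d -> A s) ->
  (forall t : R, 0 <= t <= 1 -> B t ->
     exists2 d : R, 0 < d & forall s : R, 0 <= s <= 1 -> `|s - t| < d -> B s) ->
  A 0 -> B 1 -> exists t, A t /\ B t.
Proof.
move=> AB Aop Bop A0 B1; apply: contrapT => nAB.
have dis t : A t -> B t -> False by move=> At Bt; apply: nAB; exists t.
pose S : classical_sets.set R := fun t => 0 <= t <= 1 /\ forall s, 0 <= s <= t -> A s.
have S0 : S 0.
  by split=> [|s]; [rewrite lexx ler01 | rewrite -eq_le => /eqP <-].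
have supS : classical_sets.has_sup S by split; [exists 0 | exists 1 => t [/andP[]]].
have s0 : 0 <= sup S by apply: sup_upper_bound.
have s1 : sup S <= 1 by apply: ge_sup; [exists 0 | move=> t [/andP[]]].
have below (s : R) : 0 <= s < sup S -> A s.
  move=> /andP[s_ge0 slt]; have [|t [_ At]] := sup_adherent (eps := sup S - s) _ supS.
    by rewrite subr_gt0.
  by rewrite subKr => /ltW st; apply: At; rewrite s_ge0.
have s01 : 0 <= sup S <= 1 by rewrite s0.
case: (AB _ s01) => [/(Aop _ s01)|/(Bop _ s01)] [d d0 near].
  have upper (t : R) : 0 <= t <= 1 -> t < sup S + d -> A t.
    move=> t01 td; have [tS|tS] := ltP t (sup S).
      by apply: below; case/andP: t01 => -> _.
    by apply: near => //; rewrite ger0_norm ?subr_ge0 //; lra.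
  have [h|h] := ltP 1 (sup S + d).
    by apply: (dis 1) => //; apply: upper; rewrite ?ler01 ?lexx.
  have : S (sup S + d / 2).
    split; first by lra.
    by move=> s hs; apply: upper; lra.
  by move/(sup_upper_bound supS); lra.
have [t [t01 At]] := sup_adherent d0 supS => ht.
have tS : t <= sup S by apply: sup_upper_bound.
apply: (dis t); first by apply: At; case/andP: t01 => ->; rewrite lexx.
by apply: near => //; rewrite distrC ger0_norm ?subr_ge0 //; lra.
Qed.

(** The two open sets are pulled back to the ray [t * y], which joins the apex to the given point
    inside one cone. *)
Lemma apex_connected (U V : Ttrop -> Prop) x0 x : (2 <= g)%N ->
  open_T R g U -> open_T R g V -> (forall x, U x \/ V x) ->
  sval x0 (CPt (CPair (point_graph g) set0) (fun=> 0)) ->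
  U x0 -> V x -> exists x, U x /\ V x.
Proof.
move=> hg Uop Vop UV x0P Ux0 Vx.
have [[c y] xy] := class_inhabited x; have [vc /= y0] := class_valid xy.
pose ray t := CPt c (fun e => t * y e).
have vray t : 0 <= t -> valid_cpt R g (ray t).
  by move=> t0; split=> // e; apply: mulr_ge0.
pose A (W : Ttrop -> Prop) t := exists z, W z /\ sval z (ray t).
have Aop W : open_T R g W -> forall t, 0 <= t <= 1 -> A W t ->
     exists2 d : R, 0 < d & forall s : R, 0 <= s <= 1 -> `|s - t| < d -> A W s.
  move=> Wop t /andP[t0 _] AWt; have [eps eps0 near] := Wop _ (vray t t0) AWt.
  (* This number is positive and bounds every [y e], so it serves as a Lipschitz constant of the
     ray. *)
  have M0 : 0 < 1 + \sum_e y e by rewrite ltr_wpDr // sumr_ge0.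
  exists (eps / (1 + \sum_e y e)); first exact: divr_gt0.
  move=> s /andP[s_ge0 _]; rewrite ltr_pdivlMr // => st.
  apply: (near (fun e => s * y e)) => e /=; first exact: mulr_ge0.
  rewrite -mulrBl normrM (ger0_norm (y0 e)); apply: le_lt_trans st.
  apply: ler_wpM2l => //; rewrite (bigD1 e) //= addrCA lerDl.
  by rewrite addr_ge0 // sumr_ge0.
have [|||t [[z [Uz zt]] [z' [Vz' zt']]]] := segment_connected _ (Aop U Uop) (Aop V Vop).
- move=> t /andP[t0 _]; have [z zt] := class_exists (vray t t0).
  by case: (UV z) => ?; [left|right]; exists z.
- exists x0; split=> //; apply/(class_ceq _ x0P)/ceq_sym.
  rewrite /ray (_ : (fun e => 0 * y e) = (fun=> 0)); first exact: ceq_apex.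
  by apply/funext => e; rewrite mul0r.
- exists x; split=> //; rewrite /ray (_ : (fun e => 1 * y e) = y) //.
  by apply/funext => e; rewrite mul1r.
by exists z; split=> //; rewrite (class_inj zt zt').
Qed.

Lemma Ttrop_connected : (2 <= g)%N -> connected_T R g.
Proof.
move=> hg U V Uop Vop UV [x Ux] [x' Vx'].
have [|x0 x0P] := @class_exists (CPt (CPair (point_graph g) set0) (fun=> 0)).
  by split=> //; apply: point_graph_valid.
case: (UV x0) => [Ux0|Vx0]; first exact: (apex_connected hg Uop Vop UV x0P Ux0 Vx').
have [z [? ?]] : exists z, V z /\ U z; last by exists z.
apply: (apex_connected hg Vop Uop _ x0P Vx0 Ux) => z.
by case: (UV z); [right|left].
Qed.

End Colimit.

(** * Piecewise affine functions *)

Section PiecewiseAffine.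
Variable R : realType.
Implicit Types (phi psi : R -> R) (a b c t : R) (k : int) (K : int -> Prop).

Definition affine_on phi a b k : Prop :=
  forall t, a <= t <= b -> phi t = phi a + k%:~R * (t - a).

(** An inductive form of [pw_affine], suited to induction along the pieces; [K] carries information
    on the slopes, such as their residue modulo 2. *)
Inductive pwa K phi : R -> R -> Prop :=
| PwaOne a b k of a < b & K k & affine_on phi a b k : pwa K phi a b
| PwaCons a c b k of a < c & K k & affine_on phi a c k & pwa K phi c b : pwa K phi a b.

Lemma pwa_lt K phi a b : pwa K phi a b -> a < b.
Proof. by elim=> // {}a c {}b k ac _ _ _ cb; apply: lt_trans ac cb. Qed.

Lemma pw_affineP phi a b : pw_affine R phi a b <-> pwa (fun=> True) phi a b.
Proof.
split=> [[s [srt aff]]|].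
  elim: s a srt aff => [|c s IH] a /=.
    rewrite andbT => ab /(_ 0%N isT) [k kE].
    by apply: PwaOne ab _ kE.
  move=> /andP[ac srt] aff.
  have [//|k kE] := aff 0%N.
  apply: (PwaCons ac _ kE) => //; apply: IH => // i iP.
  by have [//|k' k'E] := aff i.+1; exists k'.
elim=> {a b} [a b k ab _ kE|a c b k ac _ kE _ [s [srt aff]]].
  by exists [::]; split; rewrite /= ?ab // => -[|//] _; exists k.
exists (c :: s); split; first by rewrite /= ac.
case=> [_|i iP]; first by exists k.
by have [//|k' k'E] := aff i; exists k'.
Qed.

Lemma fwd_slope_uniq phi t k1 k2 :
  fwd_slope R phi t k1 -> fwd_slope R phi t k2 -> k1 = k2.
Proof.
move=> [d1 d1_gt0 E1] [d2 d2_gt0 E2].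
pose h := Num.min d1 d2 / 2.
have h0 : 0 < h by rewrite divr_gt0 // lt_min d1_gt0.
have hlt : h < Num.min d1 d2 by rewrite ltr_pdivrMr // ltr_pMr ?ltr1n // lt_min d1_gt0.
move: hlt; rewrite lt_min => /andP[h1 h2].
have := E1 h; rewrite E2 ?h0 ?h1 ?h2 // => /(_ isT) /addrI /(mulIf (lt0r_neq0 h0)).
by move=> /intr_inj.
Qed.

(** The centre of reflection is free: 0 transfers facts about forward slopes to backward ones, the
    edge length reverses an edge. *)
Lemma bwd_fwd_slope phi (s t : R) k :
  bwd_slope R phi t k <-> fwd_slope R (fun x => phi (s - x)) (s - t) k.
Proof.
have E1 h : s - (s - t + h) = t - h by ring.
have E2 : s - (s - t) = t by ring.
by split=> -[d d0 E]; exists d => // h /E; rewrite E1 E2.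
Qed.

Lemma fwd_bwd_slope phi (s t : R) k :
  fwd_slope R phi t k <-> bwd_slope R (fun x => phi (s - x)) (s - t) k.
Proof.
have E1 h : s - (s - t - h) = t + h by ring.
have E2 : s - (s - t) = t by ring.
by split=> -[d d0 E]; exists d => // h /E; rewrite E1 E2.
Qed.

Lemma bwd_slope_uniq phi t k1 k2 :
  bwd_slope R phi t k1 -> bwd_slope R phi t k2 -> k1 = k2.
Proof.
move=> /(bwd_fwd_slope _ 0) H1 /(bwd_fwd_slope _ 0) H2.
exact: (fwd_slope_uniq H1 H2).
Qed.

Lemma fwd_affine phi a b k t : affine_on phi a b k -> a <= t < b -> fwd_slope R phi t k.
Proof.
move=> aff /andP[at_ tb]; exists (b - t); first by rewrite subr_gt0.
by move=> h /andP[h0 hb]; rewrite aff ?[phi t]aff; [ring|lra|lra].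
Qed.

Lemma bwd_affine phi a b k t : affine_on phi a b k -> a < t <= b -> bwd_slope R phi t (- k).
Proof.
move=> aff /andP[at_ tb]; exists (t - a); first by rewrite subr_gt0.
by move=> h /andP[h0 hb]; rewrite aff ?[phi t]aff ?mulrNz; [ring|lra|lra].
Qed.

Lemma pwa_fwd K phi a b t : pwa K phi a b -> a <= t < b ->
  exists2 k, K k & fwd_slope R phi t k.
Proof.
elim=> {a b} [a b k ab Kk kE|a c b k ac Kk kE _ IH] /andP[at_ tb].
  by exists k => //; apply: fwd_affine kE _; rewrite at_.
have [tc|ct] := ltP t c; last by apply: IH; rewrite ct.
by exists k => //; apply: fwd_affine kE _; rewrite at_.
Qed.

Lemma pwa_bwd K phi a b t : pwa K phi a b -> a < t <= b ->
  exists2 k, K k & bwd_slope R phi t (- k).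
Proof.
elim=> {a b} [a b k ab Kk kE|a c b k ac Kk kE _ IH] /andP[at_ tb].
  by exists k => //; apply: bwd_affine kE _; rewrite at_.
have [ct|tc] := ltP c t; first by apply: IH; rewrite ct.
by exists k => //; apply: bwd_affine kE _; rewrite at_.
Qed.

Lemma affine_sub phi a b k a' b' : affine_on phi a b k -> a <= a' -> a' <= b' -> b' <= b ->
  affine_on phi a' b' k.
Proof. by move=> aff h1 h2 h3 t tab; rewrite aff ?[phi a']aff; [ring|lra|lra]. Qed.

Lemma pwa_split K phi a b c : pwa K phi a b -> a < c < b ->
  pwa K phi a c /\ pwa K phi c b.
Proof.
elim=> {a b} [a b k ab Kk kE|a d b k ad Kk kE db IH] /andP[ac cb].
  split; [apply: (PwaOne ac Kk)|apply: (PwaOne cb Kk)];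
  by apply: affine_sub kE _ _ _; rewrite ?lexx ?(ltW ac) ?(ltW cb).
have [cd|dc|cd] := ltgtP c d.
- split.
    by apply: (PwaOne ac Kk); apply: affine_sub kE _ _ _; rewrite ?lexx ?(ltW ac) ?(ltW cd).
  apply: (PwaCons cd Kk _ db); apply: affine_sub kE _ _ _; by rewrite ?lexx ?(ltW ac) ?(ltW cd).
- have [|H1 H2] := IH; first by rewrite dc.
  by split=> //; apply: (PwaCons ad Kk kE).
- by rewrite cd; split=> //; apply: (PwaOne ad Kk kE).
Qed.

Lemma pwa_cat K phi a b c : pwa K phi a c -> pwa K phi c b -> pwa K phi a b.
Proof.
elim=> {a c} [a c k ac Kk kE|a d c k ad Kk kE _ IH] cb; first exact: (PwaCons ac Kk kE).
by apply: (PwaCons ad Kk kE); apply: IH.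
Qed.

(** The coefficients are real, so this covers halving a function: the last hypothesis asks that the
    new slopes are still integers. *)
Lemma pwa_map K K' phi psi a b (r m n : R) : pwa K phi a b ->
  (forall t, a <= t <= b -> psi t = r * phi t + m * t + n) ->
  (forall k, K k -> exists2 k', K' k' & k'%:~R = r * k%:~R + m) -> pwa K' psi a b.
Proof.
move=> pw psiE KK'.
elim: pw psiE => {a b} [a b k ab Kk kE|a d b k ad Kk kE db IH] psiE;
  have [k' Kk' k'E] := KK' _ Kk.
  apply: (PwaOne ab Kk') => t tab; rewrite (psiE t tab) (psiE a) ?(kE t tab) ?k'E; first by ring.
  by rewrite lexx ltW.
have dblt := pwa_lt db.
apply: (PwaCons ad Kk') => [t tad|]; last by apply: IH => t tdb; apply: psiE; lra.
by rewrite (psiE t) ?(psiE a) ?(kE t tad) ?k'E; [ring|lra|lra].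
Qed.

Lemma pwa_rev K phi a b (s : R) : pwa K phi a b ->
  pwa (fun k => K (- k)) (fun t => phi (s - t)) (s - b) (s - a).
Proof.
have one (x y : R) k : x < y -> K k -> affine_on phi x y k ->
    pwa (fun k => K (- k)) (fun t => phi (s - t)) (s - y) (s - x).
  move=> xy Kk kE; apply: (@PwaOne _ _ _ _ (- k)); rewrite ?opprK //; first by lra.
  move=> t txy; rewrite kE; last by lra.
  by rewrite [phi (s - (s - y))]kE ?mulrNz; [ring|lra].
elim=> {a b} [a b k ab Kk kE|a d b k ad Kk kE _ IH]; first exact: one Kk kE.
exact: (pwa_cat IH (one _ _ _ ad Kk kE)).
Qed.

(** Passing a breakpoint changes the slope by the bend there, so all slopes agree with the initial
    one modulo [E]. It is used with the even integers, and with 0 alone to get an affine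
    function. *)
Lemma pwa_bend (E : int -> Prop) K phi a b : E 0 -> (forall x y, E x -> E y -> E (x + y)) ->
  pwa K phi a b ->
  (forall t k1 k2, a < t < b -> fwd_slope R phi t k1 -> bwd_slope R phi t k2 -> E (k1 + k2)) ->
  exists k0, fwd_slope R phi a k0 /\ pwa (fun k => E (k - k0)) phi a b.
Proof.
move=> E0 ED; elim=> {a b} [a b k ab Kk kE|a d b k ad Kk kE db IH] bend.
  exists k; split; first by apply: fwd_affine kE _; rewrite lexx ab.
  by apply: (PwaOne ab _ kE); rewrite subrr.
have dblt := pwa_lt db.
have [|k1 [fk1 pw]] := IH.
  by move=> t k1 k2 tdb; apply: bend; lra.
have Ek : E (k1 + - k).
  apply: (bend d) => //; first by rewrite ad.
  by apply: bwd_affine kE _; rewrite lexx ad.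
exists k; split; first by apply: fwd_affine kE _; rewrite lexx ad.
apply: (PwaCons ad _ kE); rewrite ?subrr //.
apply: (@pwa_map _ _ _ _ _ _ 1 0 0 pw) => [t _|k2 Ek2]; first by ring.
exists k2; last by ring.
by have := ED _ _ Ek2 Ek; rewrite addrA subrK.
Qed.

Lemma pwa_affine phi a b k0 : pwa (fun k => k - k0 = 0) phi a b -> affine_on phi a b k0.
Proof.
elim=> {a b} [a b k ab /eqP|a d b k ad /eqP]; rewrite subr_eq0 => /eqP -> // kE db IH t tab.
have dblt := pwa_lt db.
have [td|dt] := leP t d; first by apply: kE; lra.
by rewrite IH ?[phi d]kE; [ring|lra|lra].
Qed.

(** * Tent functions and their bends *)

Definition tent (p : bool) (l t : R) : R := if p then - Num.min t (l - t) else 0.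

Lemma tent_left p l t : t <= l / 2 -> tent p l t = - p%:R * t.
Proof.
move=> tl; rewrite /tent; case: p; last by rewrite oppr0 mul0r.
by rewrite min_l ?mulN1r //; lra.
Qed.

Lemma tent_right p l t : l / 2 <= t -> tent p l t = p%:R * t - p%:R * l.
Proof.
move=> tl; rewrite /tent; case: p; last by rewrite !mul0r subr0.
by rewrite min_r ?mul1r ?opprB //; lra.
Qed.

Lemma tent_affine_left p l : affine_on (tent p l) 0 (l / 2) (- p%:Z).
Proof.
move=> t /andP[t0 tl]; rewrite !tent_left //; last exact: le_trans tl.
by rewrite mulrNz mulr0 add0r subr0.
Qed.

Lemma tent_affine_right p l : affine_on (tent p l) (l / 2) l p%:Z.
Proof. by move=> t /andP[t0 tl]; rewrite !tent_right //=; ring. Qed.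

Lemma tent0 p l : 0 < l -> tent p l 0 = 0.
Proof. by move=> l0; rewrite tent_left ?mulr0 //; lra. Qed.

Lemma tentl p l : 0 < l -> tent p l l = 0.
Proof. by move=> l0; rewrite tent_right ?subrr //; lra. Qed.

Lemma pwa_tent p l : 0 < l -> pwa (fun=> True) (tent p l) 0 l.
Proof.
move=> l0; apply: (pwa_cat (c := l / 2)).
  by apply: PwaOne (@tent_affine_left p l) => //; lra.
by apply: PwaOne (@tent_affine_right p l) => //; lra.
Qed.

Lemma tent_fwd0 p l : 0 < l -> fwd_slope R (tent p l) 0 (- p%:Z).
Proof. by move=> l0; apply: fwd_affine (@tent_affine_left p l) _; lra. Qed.

Lemma tent_bwdl p l : 0 < l -> bwd_slope R (tent p l) l (- p%:Z).
Proof. by move=> l0; apply: bwd_affine (@tent_affine_right p l) _; lra. Qed.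

Lemma tent_bend p l t : 0 < t < l -> exists k1 k2,
  [/\ fwd_slope R (tent p l) t k1, bwd_slope R (tent p l) t k2 &
      k1 + k2 = 2 * (if p && (t == l / 2) then 1 else 0)].
Proof.
move=> tl; have L := @tent_affine_left p l; have H := @tent_affine_right p l.
have [tlt|ltt|->] := ltgtP t (l / 2).
- exists (- p%:Z), (- - p%:Z); split; last by rewrite andbF subrr.
    by apply: fwd_affine L _; lra.
  by apply: bwd_affine L _; lra.
- exists (p%:Z), (- p%:Z); split; last by rewrite andbF subrr.
    by apply: fwd_affine H _; lra.
  by apply: bwd_affine H _; lra.
- exists (p%:Z), (- - p%:Z); split; last by case: (p).
    by apply: fwd_affine H _; lra.
  by apply: bwd_affine L _; lra.
Qed.

Lemma fwd_slope_comb phi psi chi t k1 k2 : fwd_slope R phi t k1 -> fwd_slope R psi t k2 ->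
  (forall s, chi s = 2 * phi s + psi s) -> fwd_slope R chi t (2 * k1 + k2).
Proof.
move=> [d1 d1_gt0 E1] [d2 d2_gt0 E2] chiE.
exists (Num.min d1 d2); first by rewrite lt_min d1_gt0.
move=> h; rewrite lt_min => /andP[h0 /andP[h1 h2]].
by rewrite !chiE E1 ?E2 ?h0 // rmorphD rmorphM /=; ring.
Qed.

Lemma bwd_slope_comb phi psi chi t k1 k2 : bwd_slope R phi t k1 -> bwd_slope R psi t k2 ->
  (forall s, chi s = 2 * phi s + psi s) -> bwd_slope R chi t (2 * k1 + k2).
Proof.
move=> /(bwd_fwd_slope _ 0) H1 /(bwd_fwd_slope _ 0) H2 chiE.
by apply/(bwd_fwd_slope _ 0); apply: (fwd_slope_comb H1 H2).
Qed.

End PiecewiseAffine.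

(** * Theta characteristics *)

Section Theta.
Variable R : realType.

Lemma lin_equiv_refl (G : wgraph) (l : 'I_(ne G) -> R) Dv De Dv' De' :
  (forall e, 0 < l e) -> Dv =1 Dv' -> (forall e t, De e t = De' e t) ->
  lin_equiv R G l Dv De Dv' De'.
Proof.
move=> l0 Ev Ee; exists (fun=> 0), (fun _ _ => 0).
have aff0 (a b : R) : affine_on (fun=> 0) a b 0.
  by move=> t _; rewrite mul0r addr0.
have slf t : fwd_slope R (fun=> 0) t 0.
  by exists 1 => // h _; rewrite mul0r addr0.
have slb t : bwd_slope R (fun=> 0) t 0.
  by exists 1 => // h _; rewrite mul0r addr0.
split.
  move=> e; do 2!split=> //; apply/pw_affineP.
  exact: (PwaOne (l0 e) _ (@aff0 0 (l e))).
exists (fun=> 0), (fun=> 0); split=> //; split.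
  by move=> v; rewrite Ev subrr !big1.
split=> e t _; last by rewrite Ee subrr.
by exists 0, 0; rewrite Ee subrr.
Qed.

Lemma outside_sum (G : wgraph) (P : {set 'I_(ne G)}) v :
  (deg G v)%:Z - (degP G P v)%:Z =
  \sum_(e | src G e == v) (e \notin P)%:Z + \sum_(e | tgt G e == v) (e \notin P)%:Z.
Proof.
have -> : (deg G v)%:Z = \sum_(e | src G e == v) 1 + \sum_(e | tgt G e == v) 1.
  rewrite /deg PoszD -!sum1dep_card !(big_morph Posz PoszD (erefl _)) //.
have -> : (degP G P v)%:Z = \sum_(e | src G e == v) (e \in P)%:Z +
    \sum_(e | tgt G e == v) (e \in P)%:Z.
  rewrite /degP PoszD -!sum1dep_card !(big_morph Posz PoszD (erefl _)) /=.
  congr (_ + _); rewrite big_mkcond [RHS]big_mkcond; apply: eq_bigr => e _;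
  by case: (e \in P); case: (_ == v).
rewrite opprD addrACA -!sumrB.
by congr (_ + _); apply: eq_bigr => e _; case: (e \in P).
Qed.

Lemma TPv2 (G : wgraph) (P : {set 'I_(ne G)}) v : evenP G P ->
  2 * TPv G P v = (degP G P v)%:Z - 2 + 2 * (wt G v)%:Z.
Proof.
move=> evP; rewrite /TPv.
have := odd_double_half (degP G P v); rewrite (negbTE (evP v)) add0n.
by move: (degP G P v)./2 => h <-; lia.
Qed.

(** At a vertex, [2 T_P - K] is [degP - deg], minus the number of half-edges outside [P]; each of
    these is the start of a slope -1 of the tent. At a midpoint the bend from -1 to 1 is 2. *)
Lemma div_tent (G : wgraph) (P : {set 'I_(ne G)}) (l : 'I_(ne G) -> R) :
  (forall e, 0 < l e) -> evenP G P ->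
  is_rat R G l (fun=> 0) (fun e => tent (e \notin P) (l e)) /\
  div_is R G l (fun=> 0) (fun e => tent (e \notin P) (l e))
    (fun v => 2 * TPv G P v - canKv G v)
    (fun e t => 2 * TPe R G P l e t - canKe R G e t).
Proof.
move=> l0 evP; split.
  move=> e; split; first exact: tent0.
  by split; [exact: tentl | apply/pw_affineP; apply: pwa_tent].
exists (fun e => - (e \notin P)%:Z), (fun e => - (e \notin P)%:Z); split.
  by move=> e; split; [exact: tent_fwd0 | exact: tent_bwdl].
split.
  move=> v; rewrite TPv2 // /canKv !sumrN -opprD -outside_sum; ring.
split=> e t tl.
  have [k1 [k2 [H1 H2 H3]]] := @tent_bend R (e \notin P) (l e) t tl.
  by exists k1, k2; split=> //; split=> //; rewrite H3 /canKe subr0.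
rewrite /TPe /canKe subr0; case: ifP => // /andP[_ /eqP tE].
by case/negP: tl; rewrite tE; have := l0 e; lra.
Qed.

Lemma theta_TP (G : wgraph) (P : {set 'I_(ne G)}) (l : 'I_(ne G) -> R) :
  (forall e, 0 < l e) -> evenP G P -> theta R G l (TPv G P) (TPe R G P l).
Proof.
move=> l0 evP; split; last first.
  by exists (fun=> 0), (fun e => tent (e \notin P) (l e)); apply: div_tent.
move=> e; split=> [t|].
  by rewrite /TPe; case: ifP => // /andP[_ /eqP ->] _; have := l0 e; lra.
exists [:: l e / 2] => t; rewrite /TPe inE.
by case: ifP => // /andP[].
Qed.

Definition evenz (x : int) : Prop := exists y, x = 2 * y.

Lemma evenzVodd (x : int) : evenz x \/ evenz (x - 1).
Proof.
have [h|h] : ((x %% 2)%Z = 0 \/ (x %% 2)%Z = 1)%R by lia.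
  by left; exists (x %/ 2)%Z; lia.
by right; exists (x %/ 2)%Z; lia.
Qed.

(* [P] is the set of edges along which [f] has even slopes, where
   [2 D - K = div f]; then [f] minus the tent function of [P] can be halved. *)
Lemma theta_equiv_TP (G : wgraph) (l : 'I_(ne G) -> R) Dv De :
  (forall e, 0 < l e) -> theta R G l Dv De ->
  exists2 P, evenP G P & lin_equiv R G l Dv De (TPv G P) (TPe R G P l).
Proof.
move=> l0 [wfD [fv [fe [rat [a [b [ab [divv [dive _]]]]]]]]].
pose P := [set e | `[< evenz (a e) >]].
have parity e : evenz (a e - (e \notin P)%:Z).
  rewrite inE; case: asboolP => [|nE] /=; first by rewrite subr0.
  by case: (evenzVodd (a e)).
pose psi e t := (fe e t - tent (e \notin P) (l e) t) / 2.
have feE e t : fe e t = 2 * psi e t + tent (e \notin P) (l e) t.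
  by rewrite /psi mulrC divfK ?subrK // pnatr_eq0.
have pw e : pwa (fun=> True) (psi e) 0 (l e).
  have [_ [_ /pw_affineP pwe]] := rat e; have le0 := l0 e.
  (* The canonical divisor vanishes inside edges, so each bend of [fe e] is [2 * De e t]; all slopes
     on [e] therefore have the parity of [a e]. *)
  have [|x y [z ->] [w ->]|t k1 k2 tl H1 H2|k0 [fk0 pwk]] := pwa_bend (E := evenz) _ _ pwe.
  - by exists 0.
  - by exists (z + w); rewrite mulrDr.
  - have [k1' [k2' [H1' [H2' H3]]]] := dive e t tl.
    exists (De e t); rewrite (fwd_slope_uniq H1 H1') (bwd_slope_uniq H2 H2') -H3.
    by rewrite /canKe subr0.
  have k0E : k0 = a e := fwd_slope_uniq fk0 (ab e).1.
  have [y yE] := parity e.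
  (* The tent is affine only on each half of the edge, so the halves are treated separately. *)
  have [|pw1 pw2] := pwa_split (c := l e / 2) pwk; first by lra.
  apply: (pwa_cat (c := l e / 2)).
    apply: (pwa_map (r := 1 / 2) (m := (e \notin P)%:R / 2) (n := 0) pw1).
      by move=> t /andP[t0 tl]; rewrite /psi tent_left //; field.
    move=> k [z zE]; exists (z + y + (e \notin P)%:Z) => //.
    have -> : k = 2 * (z + y) + (e \notin P)%:Z by lia.
    by rewrite !rmorphD rmorphM /=; field.
  apply: (pwa_map (r := 1 / 2) (m := - (e \notin P)%:R / 2)
    (n := (e \notin P)%:R * l e / 2) pw2).
    by move=> t /andP[t0 tl]; rewrite /psi tent_right //; field.
  move=> k [z zE]; exists (z + y) => //.
  have -> : k = 2 * (z + y) + (e \notin P)%:Z by lia.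
  by rewrite !rmorphD rmorphM /=; field.
have /choice[al alP] e : exists k, fwd_slope R (psi e) 0 k.
  have [|k _ ?] := pwa_fwd (t := 0) (pw e); last by exists k.
  by rewrite lexx l0.
have /choice[be beP] e : exists k, bwd_slope R (psi e) (l e) k.
  have [|k _ ?] := pwa_bwd (t := l e) (pw e); last by exists (- k).
  by rewrite lexx l0.
have aE e : a e = 2 * al e - (e \notin P)%:Z.
  apply: fwd_slope_uniq (ab e).1 _.
  exact: (fwd_slope_comb (alP e) (tent_fwd0 _ (l0 e)) (feE e)).
have bE e : b e = 2 * be e - (e \notin P)%:Z.
  apply: bwd_slope_uniq (ab e).2 _.
  exact: (bwd_slope_comb (beP e) (tent_bwdl _ (l0 e)) (feE e)).
have divE v : 2 * Dv v - canKv G v =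
   2 * (\sum_(e | src G e == v) al e + \sum_(e | tgt G e == v) be e)
     - ((deg G v)%:Z - (degP G P v)%:Z).
  rewrite divv (outside_sum P) (eq_bigr _ (fun e _ => aE e)).
  rewrite [X in _ + X = _](eq_bigr _ (fun e _ => bE e)) !sumrB -!mulr_sumr; ring.
(* In [divE] the term [deg] cancels against the one in the canonical divisor, leaving [degP] equal
   to an even number. *)
have evP : evenP G P.
  move=> v; have := divE v; rewrite /canKv.
  by move: (\sum_(_ | _) _ + _) => s; lia.
exists P => //; exists (fun v => fv v / 2), psi; split.
  move=> e; have [f0 [fl _]] := rat e; rewrite /psi tent0 // tentl // !subr0 f0 fl.
  by do 2!split=> //; apply/pw_affineP; apply: pw.
exists al, be; split=> //; split.
  move=> v; have := TPv2 v evP; have := divE v; rewrite /canKv.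
  by move: (\sum_(_ | _) _ + _) => s; lia.
split=> e t tl; last first.
  rewrite /TPe; case: ifP => [/andP[_ /eqP tE]|_].
    by case/negP: tl; rewrite tE; have := l0 e; lra.
  rewrite subr0; apply/eqP; apply: contraNT tl => /((wfD e).1 t) //.
have [k1 [k2 [H1 [H2 H3]]]] := dive e t tl.
have [t0 tl'] := andP tl.
have [|m1 _ M1] := pwa_fwd (t := t) (pw e); first by rewrite ltW.
have [|m2 _ M2] := pwa_bwd (t := t) (pw e); first by rewrite t0 ltW.
have [h1 [h2 [T1 T2 T3]]] := @tent_bend R (e \notin P) (l e) t tl.
exists m1, (- m2); split=> //; split=> //.
have E1 := fwd_slope_uniq H1 (fwd_slope_comb M1 T1 (feE e)).
have E2 := bwd_slope_uniq H2 (bwd_slope_comb M2 T2 (feE e)).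
move: H3 T3; rewrite /canKe /TPe E1 E2; set x := if _ then _ else _; lia.
Qed.

(* If [T_P - T_P' = div u], then [2 u] differs from the difference of the two
   tent functions by a function without bends and with balanced slopes [s];
   its energy [sum_e l_e s_e^2] vanishes, so [s = 0], which forces the tent
   functions to have the same slopes modulo 2. *)
Lemma TP_inj (G : wgraph) (P P' : {set 'I_(ne G)}) (l : 'I_(ne G) -> R) :
  (forall e, 0 < l e) -> evenP G P -> evenP G P' ->
  lin_equiv R G l (TPv G P) (TPe R G P l) (TPv G P') (TPe R G P' l) -> P = P'.
Proof.
move=> l0 evP evP' [fv [fe [rat [a [b [ab [divv [dive _]]]]]]]].
pose d e : int := (e \notin P)%:Z - (e \notin P')%:Z.
(* Off the midpoint there is no bend, so the function has slope [a e] on the first half and [- b e]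
   on the second; [d e] is the bend between them. *)
have edge e : fv (tgt G e) - fv (src G e) = (a e - b e)%:~R * (l e / 2) /\
    - b e - a e = d e.
  have [f0 [fl /pw_affineP pwe]] := rat e; have le0 := l0 e.
  have nobend t k1 k2 : 0 < t < l e -> t != l e / 2 ->
      fwd_slope R (fe e) t k1 -> bwd_slope R (fe e) t k2 -> k1 + k2 = 0.
    move=> tl tn H1 H2; have [k1' [k2' [H1' [H2' H3]]]] := dive e t tl.
    rewrite (fwd_slope_uniq H1 H1') (bwd_slope_uniq H2 H2') -H3 /TPe.
    by rewrite (negbTE tn) !andbF subrr.
  have [|pw1 pw2] := pwa_split (c := l e / 2) pwe; first by lra.
  have D x y : x = 0 -> y = 0 -> x + y = 0 :> int by move=> -> ->.
  have [|k0 [F0 A0]] := pwa_bend (E := fun x => x = 0) (erefl _) D pw1.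
    move=> t k1 k2 tl; apply: nobend; first by lra.
    by rewrite lt_eqF //; case/andP: tl.
  have [|k1 [F1 A1]] := pwa_bend (E := fun x => x = 0) (erefl _) D pw2.
    move=> t k1 k2 tl; apply: nobend; first by lra.
    by rewrite gt_eqF //; case/andP: tl.
  have {}A0 := pwa_affine A0; have {}A1 := pwa_affine A1.
  have aE : a e = k0 := fwd_slope_uniq (ab e).1 F0.
  have bE : b e = - k1.
    by apply: bwd_slope_uniq (ab e).2 _; apply: bwd_affine A1 _; lra.
  split.
    rewrite -f0 -fl aE bE (A1 (l e)); last by lra.
    by rewrite (A0 (l e / 2)) ?opprK ?rmorphD /=; [field|lra].
  have [|m1 [m2 [M1 [M2 M3]]]] := dive e (l e / 2); first by lra.
  have E1 := fwd_slope_uniq M1 F1.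
  have E2 : m2 = - k0.
    by apply: bwd_slope_uniq M2 _; apply: bwd_affine A0 _; lra.
  rewrite aE bE opprK -E1 -E2 -M3 /TPe eqxx !andbT /d.
  by case: (e \in P); case: (e \in P').
pose s e := a e - b e.
(* Writing [s] as [2 a + d] at sources and as [- (2 b + d)] at targets turns the sum into twice the
   divisor of the function corrected by the tents, which is zero. *)
have bal v : \sum_(e | src G e == v) s e - \sum_(e | tgt G e == v) s e = 0.
  have sE e : s e = 2 * a e + d e by have := (edge e).2; rewrite /s; lia.
  have sE' e : s e = - (2 * b e + d e) by have := (edge e).2; rewrite /s; lia.
  rewrite (eq_bigr _ (fun e _ => sE e)) [X in _ - X](eq_bigr _ (fun e _ => sE' e)).
  rewrite sumrN opprK !big_split /= -!mulr_sumr /d !sumrN.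
  have := divv v; have := TPv2 v evP; have := TPv2 v evP'.
  have := outside_sum P v; have := outside_sum P' v.
  set A := \sum_(_ | _) a _; set B := \sum_(_ | _) b _.
  set S := \sum_(e | src G e == v) (e \notin P)%:Z.
  set S' := \sum_(e | src G e == v) (e \notin P')%:Z.
  set T := \sum_(e | tgt G e == v) (e \notin P)%:Z.
  set T' := \sum_(e | tgt G e == v) (e \notin P')%:Z.
  by lia.
(* Summation by parts: the balance condition paired with [fv] becomes a sum over edges of the rise
   times [s], and the rise is [s * l / 2]. *)
have energy : \sum_e (s e)%:~R ^+ 2 * l e = 0 :> R.
  have E1 : \sum_v fv v * (\sum_(e | src G e == v) s e)%:~R
      = \sum_e fv (src G e) * (s e)%:~R.
    rewrite [RHS](partition_big (src G) predT) //=; apply: eq_bigr => v _.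
    by rewrite rmorph_sum mulr_sumr; apply: eq_bigr => e /eqP <-.
  have E2 : \sum_v fv v * (\sum_(e | tgt G e == v) s e)%:~R
      = \sum_e fv (tgt G e) * (s e)%:~R.
    rewrite [RHS](partition_big (tgt G) predT) //=; apply: eq_bigr => v _.
    by rewrite rmorph_sum mulr_sumr; apply: eq_bigr => e /eqP <-.
  have : \sum_e fv (src G e) * (s e)%:~R - \sum_e fv (tgt G e) * (s e)%:~R = 0.
    rewrite -E1 -E2 -sumrB big1 // => v _.
    by rewrite -mulrBr -rmorphB /= bal mulr0.
  rewrite -sumrB (eq_bigr (fun e => - (1 / 2) * ((s e)%:~R ^+ 2 * l e))).
    rewrite -mulr_sumr => /eqP; rewrite mulf_eq0 oppr_eq0 => /orP[/eqP|/eqP //].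
    by lra.
  by move=> e _; rewrite -mulrBl -opprB (edge e).1 -/(s e); field.
apply/setP => e.
have : (s e)%:~R ^+ 2 * l e = 0.
  apply/eqP; move/eqP: energy; rewrite psumr_eq0; last first.
    by move=> i _; rewrite mulr_ge0 ?sqr_ge0 // ltW.
  by move/allP/(_ e (mem_index_enum _)).
(* From [s e = 0] follows [d e = - 2 * a e]; as [d e] is -1, 0 or 1, it is 0. *)
move/eqP; rewrite mulf_eq0 (gt_eqF (l0 e)) orbF sqrf_eq0 intr_eq0 => /eqP.
have := (edge e).2; rewrite /s /d.
by case: (e \in P); case: (e \in P') => //=; lia.
Qed.

(** * Transport of divisors along isomorphisms *)

Lemma lin_equiv_pullback (G G' : wgraph) phiV phiE fl (l : 'I_(ne G) -> R)
    (l' : 'I_(ne G') -> R) Dv De Dv' De' : giso G G' phiV phiE fl ->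
  (forall e, l' (phiE e) = l e) -> lin_equiv R G' l' Dv De Dv' De' ->
  lin_equiv R G l (fun v => Dv (phiV v))
    (fun e t => De (phiE e) (if fl e then l e - t else t))
    (fun v => Dv' (phiV v))
    (fun e t => De' (phiE e) (if fl e then l e - t else t)).
Proof.
move=> [bijV [bijE [_ ends]]] lE [fv [fe [rat [a [b [ab [divv [dive dive0]]]]]]]].
exists (fun v => fv (phiV v)),
  (fun e t => fe (phiE e) (if fl e then l e - t else t)); split.
  move=> e; have := ends e; have := rat (phiE e); rewrite lE.
  case: (fl e) => -[f0 [f1 pw]] [<- <-]; last by [].
  rewrite subr0 subrr; do 2!split=> //; apply/pw_affineP.
  move/pw_affineP/(pwa_rev (l e)): pw; rewrite subrr subr0 => pw.
  by apply: (pwa_map (r := 1) (m := 0) (n := 0) pw) => [t _|k _];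
    [ring | exists k => //; ring].
(* Reversing an edge exchanges the outgoing slopes at its two ends. *)
exists (fun e => if fl e then b (phiE e) else a (phiE e)),
  (fun e => if fl e then a (phiE e) else b (phiE e)); split.
  move=> e; have [A B] := ab (phiE e); rewrite lE in B.
  case: (fl e) => //; split.
    by have := (bwd_fwd_slope (fe (phiE e)) (l e) (l e) _).1 B; rewrite subrr.
  by have := (fwd_bwd_slope (fe (phiE e)) (l e) 0 _).1 A; rewrite subr0.
split.
  move=> v; rewrite divv (reindex phiE) ?[X in _ + X = _](reindex phiE) /=;
    try exact: onW_bij.
  rewrite [X in X + _ = _]big_mkcond [X in _ + X = _]big_mkcond.
  rewrite [X in _ = X + _]big_mkcond [X in _ = _ + X]big_mkcond -!big_split /=.
  apply: eq_bigr => e _; have := ends e.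
  by case: (fl e) => -[-> ->]; rewrite !(bij_eq bijV) // addrC.
split=> e t tl.
  have := dive (phiE e) (if fl e then l e - t else t); rewrite lE.
  case: (fl e) => [[|k1 [k2 [K1 [K2 ->]]]]|]; [by lra| |exact].
  exists k2, k1; rewrite addrC; split.
    by have := (bwd_fwd_slope (fe (phiE e)) (l e) (l e - t) _).1 K2; rewrite subKr.
  split=> //.
  by have := (fwd_bwd_slope (fe (phiE e)) (l e) (l e - t) _).1 K1; rewrite subKr.
have := dive0 (phiE e) (if fl e then l e - t else t); rewrite lE; apply.
by apply: contra tl; case: (fl e) => //; lra.
Qed.

Lemma degP_giso (G G' : wgraph) (P : {set 'I_(ne G)}) (P' : {set 'I_(ne G')})
    phiV phiE fl v : giso G G' phiV phiE fl ->
  (forall e, (phiE e \in P') = (e \in P)) -> degP G' P' (phiV v) = degP G P v.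
Proof.
move=> [bijV [bijE [wtE ends]]] PE.
rewrite !degPE (reindex phiE) /=; last exact: onW_bij.
apply: eq_big => [e|e _]; first exact: PE.
have := ends e; case: (fl e) => -[-> ->]; rewrite !(bij_eq bijV) //.
by rewrite addnC.
Qed.

Lemma TPv_giso (G G' : wgraph) (P : {set 'I_(ne G)}) (P' : {set 'I_(ne G')})
    phiV phiE fl v : giso G G' phiV phiE fl ->
  (forall e, (phiE e \in P') = (e \in P)) -> TPv G' P' (phiV v) = TPv G P v.
Proof.
by move=> iso PE; rewrite /TPv (degP_giso v iso PE); case: iso => _ [_ [->]].
Qed.

Lemma TPe_giso (G G' : wgraph) (P : {set 'I_(ne G)}) (P' : {set 'I_(ne G')})
    phiE (fl : 'I_(ne G) -> bool) (l : 'I_(ne G) -> R) (l' : 'I_(ne G') -> R) e t :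
  (forall e, (phiE e \in P') = (e \in P)) -> (forall e, l' (phiE e) = l e) ->
  TPe R G' P' l' (phiE e) (if fl e then l e - t else t) = TPe R G P l e t.
Proof.
move=> PE lE; rewrite /TPe PE lE; case: (fl e) => //.
by rewrite (_ : (l e - t == l e / 2) = (t == l e / 2)) //; apply/eqP/eqP; lra.
Qed.

End Theta.

(** * From positive length vectors to curves with a theta characteristic *)

Section Realization.
Variables (R : realType) (g : nat).

Definition curve_of (c : cpair) (l : 'I_(ne (cG c)) -> R) : tpair R :=
  TPair R (cG c) l (TPv (cG c) (cP c)) (TPe R (cG c) (cP c) l).

Lemma curve_of_valid c l : valid_cpair g c -> (forall e, 0 < l e) ->
  valid_tpair R g (curve_of (c := c) l).
Proof. by move=> [sG evP] l0; split=> //; split=> //; apply: theta_TP. Qed.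

Lemma curve_of_iso c l c' l' : valid_cpair g c -> (forall e, 0 < l e) ->
  (forall e, 0 < l' e) -> ceq R g (CPt R c l) (CPt R c' l') ->
  pair_iso R (curve_of l) (curve_of l').
Proof.
move=> vc l0 l0' /(ceq_giso vc l0 l0') [phiV [phiE [fl [iso PE lE]]]].
exists phiV, phiE, fl; split=> //; split=> //=.
apply: lin_equiv_refl => // [v|e t]; first exact: (TPv_giso v iso PE).
exact: TPe_giso.
Qed.

(** The set [cP c'] is pulled back to [P2] on the graph of [c]; both sets then give equivalent
    divisors on one curve, and [TP_inj] identifies them. *)
Lemma curve_of_inj c l c' l' : valid_cpair g c -> valid_cpair g c' ->
  (forall e, 0 < l e) -> pair_iso R (curve_of l) (curve_of l') ->
  ceq R g (CPt R c l) (CPt R c' l').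
Proof.
move=> vc vc' l0 [phiV [phiE [fl [/= iso [lE lin]]]]].
pose P2 := [set e | phiE e \in cP c'].
have PE e : (phiE e \in cP c') = (e \in P2) by rewrite inE.
have ev2 : evenP (cG c) P2.
  by move=> v; rewrite -(degP_giso v iso PE); exact: vc'.2.
suff P2E : P2 = cP c by apply: (giso_ceq vc vc' l0 iso _ lE) => e; rewrite PE P2E.
apply: (TP_inj l0 ev2 vc.2); move: lin; congr (lin_equiv _ _ _ _ _ _ _).
  by apply/funext => v; exact: (TPv_giso v iso PE).
by apply/funext => e'; apply/funext => t; exact: TPe_giso.
Qed.

(** The conclusion covers all positive representatives of the class, because the map on points uses
    a chosen one that need not be [(c, l)]. *)
Lemma curve_of_surj p : valid_tpair R g p ->
  exists c l, [/\ valid_cpair g c, forall e, 0 < l e &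
    forall c' l', valid_cpair g c' -> (forall e, 0 < l' e) ->
      ceq R g (CPt R c' l') (CPt R c l) -> pair_iso R (curve_of l') p].
Proof.
case: p => G l Dv De [/= sG [l0 th]].
have [P evP lin] := theta_equiv_TP l0 th.
exists (CPair G P), l; split=> // c' l' vc' l0'.
move=> /(@ceq_giso _ _ _ _ (CPair G P) l vc' l0' l0) [phiV [phiE [fl [/= iso PE lE]]]].
exists phiV, phiE, fl; split=> //; split=> //=.
have := lin_equiv_pullback iso lE lin; congr (lin_equiv _ _ _ _ _ _ _).
  by apply/funext => v; exact: (TPv_giso v iso PE).
by apply/funext => e'; apply/funext => t; exact: TPe_giso.
Qed.

End Realization.

Theorem theorem4p1 (R : realType) (g : nat) (hg : (2 <= g)%N) :
  (* (1) points <-> isomorphism classes of pairs (Gamma, theta) *)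
  (exists F : Ttrop R g -> tpair R,
     (forall x, valid_tpair R g (F x)) /\
     (forall (c : cpair) (l : 'I_(ne (cG c)) -> R) (x : Ttrop R g),
        valid_cpair g c -> (forall e, 0 < l e) -> sval x (CPt R c l) ->
        pair_iso R (F x) (TPair R (cG c) l (TPv (cG c) (cP c))
                                           (TPe R (cG c) (cP c) l))) /\
     (forall x y, pair_iso R (F x) (F y) -> x = y) /\
     (forall p, valid_tpair R g p -> exists x, pair_iso R (F x) p)) /\
  (* (1) stratification over isomorphism classes of pairs (G, P) *)
  (forall x : Ttrop R g, exists c, valid_cpair g c /\ stratum R g c x) /\
  (forall c c', valid_cpair g c -> valid_cpair g c' ->
     (exists x, stratum R g c x /\ stratum R g c' x) -> cpair_iso c c') /\
  (forall c c', valid_cpair g c -> valid_cpair g c' -> cpair_iso c c' ->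
     forall x, stratum R g c x <-> stratum R g c' x) /\
  (* (2) T^trop_(G,P) = sigma^o_(G,P) / Aut(G,P) *)
  (forall c, valid_cpair g c ->
     (forall l l' : 'I_(ne (cG c)) -> R, (forall e, 0 < l e) -> (forall e, 0 < l' e) ->
        ((exists x : Ttrop R g, sval x (CPt R c l) /\ sval x (CPt R c l')) <->
         exists phiV phiE fl, giso (cG c) (cG c) phiV phiE fl /\
           (forall e, (phiE e \in cP c) = (e \in cP c)) /\
           (forall e, l' (phiE e) = l e))) /\
     (forall O : ('I_(ne (cG c)) -> R) -> Prop,
        (forall l, O l -> (forall e, 0 < l e) /\
           exists2 eps : R, 0 < eps & forall l', (forall e, 0 < l' e) ->
             (forall e, `|l' e - l e| < eps) -> O l') ->
        exists W : Ttrop R g -> Prop, open_T R g W /\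
          forall x, (stratum R g c x /\ W x) <->
                    exists l, O l /\ sval x (CPt R c l))) /\
  (* (3) connected, of pure dimension 3g - 3 *)
  connected_T R g /\
  (exists c, valid_cpair g c /\ ne (cG c) = (3 * g - 3)%N) /\
  (forall c, valid_cpair g c -> cmaximal g c -> ne (cG c) = (3 * g - 3)%N) /\
  (* (4) closure of strata *)
  (forall c c', valid_cpair g c -> valid_cpair g c' ->
     ((forall x, stratum R g c' x -> closure_T R g (stratum R g c) x) <-> cge c c')).
Proof.
split.
  (* A positive representative is chosen in each class; the resulting pair depends on the choice
     only up to isomorphism. *)
  have /choice[nf nfP] x : exists cl : cpt R,
      [/\ valid_cpair g (ci R cl), forall e, 0 < cx R cl e & sval (x : Ttrop R g) cl].
    by have [c [l H]] := class_normal_form x; exists (CPt R c l).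
  exists (fun x => curve_of (cx R (nf x))); split.
    by move=> x; have [vc l0 _] := nfP x; apply: curve_of_valid.
  have nfE x : nf x = CPt R (ci R (nf x)) (cx R (nf x)) by case: (nf x).
  have nf_class x : sval x (CPt R (ci R (nf x)) (cx R (nf x))).
    by rewrite -nfE; case: (nfP x).
  split.
    move=> c l x vc l0 xl; have [vc0 l00 _] := nfP x.
    exact: (curve_of_iso vc0 l00 l0 ((class_ceq _ (nf_class x)).1 xl)).
  split.
    move=> x y xy; have [vcx lx _] := nfP x; have [vcy _ _] := nfP y.
    apply: (class_inj _ (nf_class y)); apply/(class_ceq _ (nf_class x)).
    exact: curve_of_inj.
  move=> p /curve_of_surj [c [l [vc l0 H]]].
  have [x xl] := class_exists (valid_pos vc l0).
  have [vc0 l00 _] := nfP x.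
  by exists x; apply: H => //; apply/(class_ceq _ (nf_class x)).
split.
  by move=> x; have [c [l [vc l0 xl]]] := class_normal_form x; exists c; split=> //; exists l.
split.
  move=> c c' vc vc' [x [[l [l0 xl]] [l' [l0' xl']]]].
  have := ceq_giso vc l0 l0' ((class_ceq _ xl).1 xl').
  by move=> [phiV [phiE [fl [iso PE _]]]]; exists phiV, phiE, fl.
split.
  have sub c c' : valid_cpair g c -> valid_cpair g c' -> cpair_iso c c' ->
      forall x, stratum R g c' x -> stratum R g c x.
    move=> vc vc' [phiV [phiE [fl [iso PE]]]] x [l [l0 xl]].
    exists (fun e => l (phiE e)); split=> //; apply/(class_ceq _ xl)/ceq_sym.
    exact: (giso_ceq vc vc' _ iso PE).
  have sub' c c' : valid_cpair g c -> valid_cpair g c' -> cpair_iso c c' ->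
      forall x, stratum R g c x -> stratum R g c' x.
    move=> vc vc' [phiV [phiE [fl [iso PE]]]] x [l [l0 xl]].
    have [_ [[psiE K1 K2] _]] := iso.
    exists (fun e => l (psiE e)); split=> //; apply/(class_ceq _ xl).
    by apply: (giso_ceq vc vc' l0 iso PE) => e; rewrite K1.
  by move=> c c' vc vc' cc' x; split; [exact: sub' | exact: sub].
split.
  move=> c vc; split=> [l l' l0 l0'|O Oop].
    split=> [[x [xl xl']]|[phiV [phiE [fl [iso [PE lE]]]]]].
      have := ceq_giso vc l0 l0' ((class_ceq _ xl).1 xl').
      by move=> [phiV [phiE [fl [iso PE lE]]]]; exists phiV, phiE, fl.
    have [x xl] := class_exists (valid_pos vc l0); exists x; split=> //.
    by apply/(class_ceq _ xl)/(giso_ceq vc vc l0 iso PE lE).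
  exists (star (g := g) O); split; first exact: star_open.
  by move=> x; apply: stratum_star.
split; first exact: Ttrop_connected.
split; first exact: exists_top.
split; last exact: stratum_ge.
(* A cone of another dimension is a proper face of the cone of its expansion, contradicting
   maximality. *)
move=> c vc cmax; apply: contrapT => /(expand vc) [c1 [gV [gE [fl [gM vc1 [e]]]]]].
by rewrite (cmax c1 vc1 gV gE fl gM).
Qed.
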